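(* Let $p \ge 3$ be odd and let $q$ be an even divisor of $2p$. Let $\Gamma(p,q)$ be the group with presentation $$\langle \rho_0,\rho_1,\rho_2 \mid \rho_0^2,\ \rho_1^2,\ \rho_2^2,\ (\rho_0\rho_1)^p,\ (\rho_1\rho_2)^q,\ (\rho_0\rho_2)^2,\ (\rho_0\rho_1\rho_2\rho_1\rho_2)^2\rangle.$$ Then there is a tight orientably-regular polyhedron $\mathcal{P}$ of type $\{p,q\}$ whose automorphism group is isomorphic to $\Gamma(p,q)$.
   Context: A polyhedron is an abstract polytope of rank $3$. An abstract polytope of rank $n$ is a ranked poset (ranks $-1$ to $n$) with unique least and greatest faces, all flags (maximal chains) having $n+2$ faces, all sections connected, and satisfying the diamond condition (between incident faces of ranks $j-1$ and $j+1$ there are exactly two $j$-faces). A polyhedron has type $\{p,q\}$ if every $2$-face is a $p$-gon and every vertex-figure is a $q$-gon; it is tight if it has exactly $2pq$ flags. It is regular if its automorphism group acts transitively on flags, in which case the group is generated by the reflections $\rho_0,\rho_1,\rho_2$ with respect to a base flag $\Phi$ ($\rho_i$ maps $\Phi$ to the flag differing from it only in the $i$-face); it is orientably-regular if the rotation subgroup $\langle \rho_0\rho_1,\rho_1\rho_2\rangle$ has index $2$ in the automorphism group. *)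

(* Defs.v *)
From HB Require Import structures.
From mathcomp Require Import all_boot all_order all_algebra all_fingroup.
From mathcomp Require Import generic_quotient boolp.

Set Implicit Arguments.
Unset Strict Implicit.
Unset Printing Implicit Defensive.

Import Order.TTheory GroupScope.

(* Only finite posets are considered. A polytope with finitely many flags has
   finitely many faces, since every face lies on a flag; so tight polyhedra
   are always of this kind. *)

Section Flags.
Variables (d : Order.disp_t) (T : finTBPOrderType d).
Local Open Scope order_scope.

Definition is_chain (C : {set T}) : bool :=
  [forall x in C, forall y in C, x >=< y].

Definition is_flag (F : {set T}) : bool := maxset is_chain F.

(* Two proper faces of the section [y / x] joined by a sequence of proper
   faces of that section, consecutive ones being incident. *)
Definition section_connect (x y : T) : rel T :=
  connect [rel u v | [&& x < u < y, x < v < y & u >=< v]].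

End Flags.

(* The least and greatest faces are [\bot] and [\top], of ranks -1 and n. As
   usual, sections of rank at most 1 count as connected; the section [y / x]
   has rank [rank y - rank x - 1]. *)
Record polytope (n : nat) := Polytope {
  face_disp : Order.disp_t;
  face :> finTBPOrderType face_disp;
  rank : face -> int;
  rank_bot : rank \bot%O = (- 1)%R;
  rank_top : rank \top%O = n%:Z%R;
  rank_cover : forall x y : face,
    (x < y)%O -> (forall z : face, ~~ (x < z < y)%O) ->
    rank y = (rank x + 1)%R;
  card_flag : forall F : {set face}, is_flag F -> #|F| = (n + 2)%N;
  sections_connected : forall x y : face,
    (x <= y)%O -> (2 <= rank y - rank x - 1)%R ->
    forall u v : face, (x < u < y)%O -> (x < v < y)%O ->
    section_connect x y u v;
  diamond : forall (j : int) (x y : face),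
    rank x = (j - 1)%R -> rank y = (j + 1)%R -> (x <= y)%O ->
    #|[set z : face | (rank z == j) && (x <= z <= y)%O]| = 2%N
}.

Notation polyhedron := (polytope 3).

Section PolytopeTheory.
Variables (n : nat) (P : polytope n).

Definition flags : {set {set P}} := [set F | is_flag F].

Definition automs : {set {perm P}} :=
  [set s : {perm P} | [forall x, forall y, (s x <= s y)%O == (x <= y)%O]].

Lemma automsP (s : {perm P}) :
  reflect (forall x y, (s x <= s y)%O = (x <= y)%O) (s \in automs).
Proof.
rewrite inE; apply: (iffP forallP) => [H x y | H x].
  by have /forallP/(_ y)/eqP := H x.
by apply/forallP => y; rewrite H.
Qed.

Lemma automs_group_set : group_set automs.
Proof.
apply/group_setP; split; first by apply/automsP => x y; rewrite !perm1.
move=> s t /automsP sP /automsP tP; apply/automsP => x y.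
by rewrite !permM tP sP.
Qed.

Canonical automs_group : {group {perm P}} := Group automs_group_set.

Definition regular : Prop := [transitive automs, on flags | 'P^*].

(* The flag [F'] differs from the flag [F] in its face of rank [i] only. *)
Definition adjacent (i : int) (F F' : {set P}) : Prop :=
  [/\ F \in flags, F' \in flags, F' != F &
      forall x : P, rank x != i -> (x \in F') = (x \in F)].

Definition is_reflection (Phi : {set P}) (i : int) (r : {perm P}) : Prop :=
  r \in automs /\ adjacent i Phi ('P^*%act Phi r).

End PolytopeTheory.

Inductive polygon_face (k : nat) :=
  | Pempty
  | Pvertex of 'I_k
  | Pedge of 'I_k
  | Pfull.

Arguments Pempty {k}.
Arguments Pfull {k}.

(* The edge j of the k-gon joins the vertices j and j + 1 modulo k; for k = 2
   this is the digon, with two edges on the same two vertices. *)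
Definition polygon_le (k : nat) (u v : polygon_face k) : bool :=
  match u, v with
  | Pempty, _ => true
  | _, Pfull => true
  | Pvertex i, Pvertex j => i == j
  | Pvertex i, Pedge j => (i == j :> nat) || (i == j.+1 %% k :> nat)
  | Pedge i, Pedge j => i == j
  | _, _ => false
  end.

Section Polyhedra.
Variable P : polyhedron.

(* The section [y / x] is isomorphic to the face poset of a k-gon. The map f
   is automatically injective, [polygon_le] being antisymmetric. *)
Definition is_polygon_section (k : nat) (x y : P) : Prop :=
  exists f : polygon_face k -> P,
    (forall z : P, (x <= z <= y)%O <-> exists u, z = f u) /\
    (forall u v, (f u <= f v)%O = polygon_le u v).

Definition has_type (p q : nat) : Prop :=
  (forall F : P, rank F = 2%Z -> is_polygon_section p \bot%O F) /\
  (forall v : P, rank v = 0%Z -> is_polygon_section q v \top%O).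

Definition tight (p q : nat) : Prop := #|flags P| = (2 * p * q)%N.

Definition orientably_regular : Prop :=
  regular P /\
  exists (Phi : {set P}) (r0 r1 r2 : {perm P}),
    [/\ Phi \in flags P,
        is_reflection Phi 0%Z r0,
        is_reflection Phi 1%Z r1,
        is_reflection Phi 2%Z r2 &
        #|automs P : <<[set r0 * r1; r1 * r2]>>| = 2%N].

End Polyhedra.

(* The letter (x, false) stands for the generator x, (x, true) for x^-1. *)
Definition word (X : Type) := seq (X * bool).

Definition word_inv (X : Type) (w : word X) : word X :=
  rev [seq (a.1, ~~ a.2) | a <- w].

Definition word_exp (X : Type) (w : word X) (n : nat) : word X :=
  flatten (nseq n w).

Section Presentation.
Variables (X : choiceType) (R : seq (word X)).

Inductive word_eqv : word X -> word X -> Prop :=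
  | word_eqv_refl w : word_eqv w w
  | word_eqv_sym w1 w2 : word_eqv w1 w2 -> word_eqv w2 w1
  | word_eqv_trans w1 w2 w3 :
      word_eqv w1 w2 -> word_eqv w2 w3 -> word_eqv w1 w3
  | word_eqv_cancel u v x b :
      word_eqv (u ++ [:: (x, b); (x, ~~ b)] ++ v) (u ++ v)
  | word_eqv_relator u v r : r \in R -> word_eqv (u ++ r ++ v) (u ++ v).

Definition word_eqvb (w1 w2 : word X) : bool := `[< word_eqv w1 w2 >].

Lemma word_eqvb_refl : reflexive word_eqvb.
Proof. by move=> w; apply/asboolP; apply: word_eqv_refl. Qed.

Lemma word_eqvb_sym : symmetric word_eqvb.
Proof. by move=> u v; apply/asboolP/asboolP; apply: word_eqv_sym. Qed.

Lemma word_eqvb_trans : transitive word_eqvb.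
Proof.
by move=> v u w /asboolP uv /asboolP vw; apply/asboolP; apply: word_eqv_trans vw.
Qed.

Canonical word_eqv_equiv :=
  EquivRel word_eqvb word_eqvb_refl word_eqvb_sym word_eqvb_trans.

Definition presented := {eq_quot word_eqv_equiv}%qT.
HB.instance Definition _ := Choice.on presented.
HB.instance Definition _ := EqQuotient.on presented.

Local Open Scope quotient_scope.

Lemma word_piP (u v : word X) :
  reflect (\pi_presented u = \pi_presented v) (word_eqvb u v).
Proof. exact/eqmodP. Qed.

Lemma word_eqv_cat2 (a b u v : word X) :
  word_eqv u v -> word_eqv (a ++ u ++ b) (a ++ v ++ b).
Proof.
elim=> {u v} [w|w1 w2 _|w1 w2 w3 _ IH1 _ IH2|u v x c|u v r rR].
- exact: word_eqv_refl.
- exact: word_eqv_sym.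
- exact: word_eqv_trans IH1 IH2.
- rewrite -!catA !(catA a u); exact: word_eqv_cancel.
- rewrite -!catA !(catA a u); exact: word_eqv_relator.
Qed.

Lemma word_eqv_cat (u u' v v' : word X) :
  word_eqv u u' -> word_eqv v v' -> word_eqv (u ++ v) (u' ++ v').
Proof.
move=> uu' vv'; apply: (@word_eqv_trans _ (u' ++ v)).
  exact: (@word_eqv_cat2 [::] v).
by have := @word_eqv_cat2 u' [::] _ _ vv'; rewrite !cats0.
Qed.

Lemma word_invK : involutive (@word_inv X).
Proof.
move=> w; rewrite /word_inv map_rev revK -map_comp -[RHS]map_id.
by apply: eq_map => -[x b] /=; rewrite negbK.
Qed.

Lemma word_inv_cat (u v : word X) :
  word_inv (u ++ v) = word_inv v ++ word_inv u.
Proof. by rewrite /word_inv map_cat rev_cat. Qed.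

Lemma word_mulV (w : word X) : word_eqv (w ++ word_inv w) [::].
Proof.
elim: w => [|[x b] w IH]; first exact: word_eqv_refl.
rewrite -cat1s word_inv_cat -catA (catA w).
apply: word_eqv_trans (word_eqv_cat2 [:: (x, b)] (word_inv [:: (x, b)]) IH) _.
exact: (word_eqv_cancel [::] [::]).
Qed.

Lemma word_Vmul (w : word X) : word_eqv (word_inv w ++ w) [::].
Proof. by rewrite -{2}[w]word_invK; apply: word_mulV. Qed.

Lemma word_eqv_inv (u v : word X) :
  word_eqv u v -> word_eqv (word_inv u) (word_inv v).
Proof.
move=> uv.
apply: (@word_eqv_trans _ (word_inv u ++ v ++ word_inv v)).
  apply: word_eqv_sym; rewrite -{2}[word_inv u]cats0.
  by apply: word_eqv_cat (word_mulV v); apply: word_eqv_refl.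
apply: (@word_eqv_trans _ (word_inv u ++ u ++ word_inv v)).
  by apply: word_eqv_cat2; apply: word_eqv_sym.
rewrite catA; apply: (@word_eqv_cat _ [::] _ _ (word_Vmul u)).
exact: word_eqv_refl.
Qed.

Definition pres_one : presented := \pi_presented [::].
Definition pres_mul (g h : presented) : presented :=
  \pi_presented (repr g ++ repr h).
Definition pres_inv (g : presented) : presented :=
  \pi_presented (word_inv (repr g)).

Lemma word_repr_pi (w : word X) : word_eqv (repr (\pi_presented w)) w.
Proof. by apply/asboolP/word_piP; rewrite reprK. Qed.

Lemma pres_mulE (u v : word X) :
  pres_mul (\pi u) (\pi v) = \pi_presented (u ++ v).
Proof.
by apply/word_piP/asboolP; apply: word_eqv_cat; apply: word_repr_pi.
Qed.

Lemma pres_invE (u : word X) :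
  pres_inv (\pi u) = \pi_presented (word_inv u).
Proof. by apply/word_piP/asboolP; apply/word_eqv_inv/word_repr_pi. Qed.

Lemma pres_mulA : associative pres_mul.
Proof.
elim/quotW=> u; elim/quotW=> v; elim/quotW=> w.
by rewrite !pres_mulE catA.
Qed.

Lemma pres_mul1 : left_id pres_one pres_mul.
Proof. by elim/quotW=> u; rewrite pres_mulE. Qed.

Lemma pres_1mul : right_id pres_one pres_mul.
Proof. by elim/quotW=> u; rewrite pres_mulE cats0. Qed.

Lemma pres_mulVg : left_inverse pres_one pres_inv pres_mul.
Proof.
elim/quotW=> u; rewrite pres_invE pres_mulE.
by apply/word_piP/asboolP/word_Vmul.
Qed.

Lemma pres_mulgV : right_inverse pres_one pres_inv pres_mul.
Proof.
elim/quotW=> u; rewrite pres_invE pres_mulE.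
by apply/word_piP/asboolP/word_mulV.
Qed.

HB.instance Definition _ := isGroup.Build presented
  pres_mulA pres_mul1 pres_1mul pres_mulVg pres_mulgV.

End Presentation.

Definition isomorphic (G H : groupType) : Prop :=
  exists f : G -> H, bijective f /\ {morph f : x y / x * y}.

Definition rho0 : word 'I_3 := [:: (@Ordinal 3 0 isT, false)].
Definition rho1 : word 'I_3 := [:: (@Ordinal 3 1 isT, false)].
Definition rho2 : word 'I_3 := [:: (@Ordinal 3 2 isT, false)].

Definition Gamma_relators (p q : nat) : seq (word 'I_3) :=
  [:: word_exp rho0 2; word_exp rho1 2; word_exp rho2 2;
      word_exp (rho0 ++ rho1) p;
      word_exp (rho1 ++ rho2) q;
      word_exp (rho0 ++ rho2) 2;
      word_exp (rho0 ++ rho1 ++ rho2 ++ rho1 ++ rho2) 2].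

Definition Gamma (p q : nat) : groupType := presented (Gamma_relators p q).

(* Main.v *)
From HB Require Import structures.
Require Import Defs.
From mathcomp Require Import all_boot all_order all_algebra all_fingroup.
From mathcomp Require Import generic_quotient boolp ring zify.

Set Implicit Arguments.
Unset Strict Implicit.
Unset Printing Implicit Defensive.

Import Order.TTheory GRing.Theory.

(* Write q = 2m, so that m divides p. The polyhedron is explicit: its vertices
   are the i in Z/p, its edges the pairs (i, a) in Z/p x Z/m, with (i, a)
   joining i to i + 1, and its 2-faces the pairs (c, k) in Z/m x {0, 1}. Every
   vertex is on every 2-face, and (i, a) is on (a, 0) and (a + i, 1). A flag is
   thus an edge with a choice of one of its two vertices and of one of its two
   2-faces, which makes 4pm = 2pq flags.

   With T = r0 r1 and N = (r1 r2)^2, the relations of Gamma(p, q) say that all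
   three generators invert N, and they give T r2 = r2 T N; hence every element
   has the form r2^d r0^e T^s N^t with d, e < 2, s < p and t < m. The
   corresponding reflections of the polyhedron satisfy the relations, and
   r2^d r0^e T^s N^t moves the base flag to the flag with edge (-s, t) whose
   vertex and 2-face are selected by e and d. So these products are distinct
   and transitive on flags, and, since an automorphism fixing a flag is
   trivial, they exhaust the automorphism group. *)

(** * Homomorphisms from a presented group *)

Section Evaluation.
Local Open Scope group_scope.
Variables (X : choiceType) (R : seq (word X)).

Section Eval.
Variables (G : groupType) (a : X -> G).

Definition eval_word (w : word X) : G :=
  \prod_(l <- w) (if l.2 then (a l.1)^-1 else a l.1).

Lemma eval_cat u v : eval_word (u ++ v) = eval_word u * eval_word v.
Proof. exact: big_cat. Qed.

Lemma eval_exp w n : eval_word (word_exp w n) = eval_word w ^+ n.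
Proof.
elim: n => [|n IHn]; first by rewrite /eval_word big_nil expg0.
by rewrite /word_exp /= eval_cat IHn expgS.
Qed.

Lemma eval1 x b : eval_word [:: (x, b)] = if b then (a x)^-1 else a x.
Proof. exact: big_seq1. Qed.

Hypothesis evalR : forall r, r \in R -> eval_word r = 1.

Lemma eval_eqv u v : word_eqv R u v -> eval_word u = eval_word v.
Proof.
elim=> {u v} [w||||] //; first by move=> u v w _ -> _ ->.
  move=> u v x b; rewrite !eval_cat; congr (_ * _).
  rewrite -cat1s eval_cat !eval1.
  by case: b; rewrite /= ?mulgV ?mulVg mul1g.
by move=> u v r /evalR rR; rewrite !eval_cat rR mul1g.
Qed.

Definition pres_eval (g : presented R) : G := eval_word (repr g).

(** The chosen representative of a class does not matter: equivalent words have equal values once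
    all relators evaluate to 1. *)
Lemma pres_eval_pi w : pres_eval (\pi_(presented R)%qT w) = eval_word w.
Proof. exact/eval_eqv/word_repr_pi. Qed.

Lemma pres_evalM : {morph pres_eval : g h / g * h}.
Proof. by move=> g h; rewrite [LHS]pres_eval_pi eval_cat. Qed.

End Eval.

Definition pres_gen (x : X) : presented R :=
  \pi_(presented R)%qT [:: (x, false)].

Lemma pi_cat u v :
  \pi_(presented R)%qT (u ++ v) =
  \pi_(presented R)%qT u * \pi_(presented R)%qT v.
Proof. by rewrite -[LHS]pres_mulE. Qed.

Lemma pi_eval w : \pi_(presented R)%qT w = eval_word pres_gen w.
Proof.
elim: w => [|[x b] w IHw]; first by rewrite /eval_word big_nil.
rewrite -cat1s pi_cat IHw eval_cat; congr (_ * _).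
by rewrite eval1; case: b => //; apply/esym/(@pres_invE X R [:: (x, false)]).
Qed.

Lemma pres_relator r : r \in R -> eval_word pres_gen r = 1.
Proof.
move=> rR; rewrite -pi_eval; apply/word_piP/asboolP.
by have := word_eqv_relator [::] [::] rR; rewrite cats0.
Qed.

(** Letters are appended on the right, to match the stability of the normal form under right
    multiplication by a generator. *)
Lemma pres_ind (S : presented R -> Prop) :
  S 1 -> (forall g x, S g -> S (g * pres_gen x)) ->
  (forall g x, S g -> S (g * (pres_gen x)^-1)) -> forall g, S g.
Proof.
move=> S1 Sg SV; elim/quotW; elim/last_ind => [|w [x b] IHw] //.
rewrite -cats1 pi_cat [X in _ * X]pi_eval eval1.
by case: b; [apply: SV | apply: Sg].
Qed.

End Evaluation.

(** * Normal form in the group *)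

Section NormalForm.
Local Open Scope group_scope.
Variables (G : groupType) (r0 r1 r2 : G) (p m : nat).
Hypotheses (r0K : r0 * r0 = 1) (r1K : r1 * r1 = 1) (r2K : r2 * r2 = 1).
Hypothesis sp : (r0 * r1) ^+ p.+1 = 1.
Hypothesis sq : (r1 * r2) ^+ (m.+1).*2 = 1.
Hypothesis s02 : (r0 * r2) ^+ 2 = 1.
Hypothesis s012 : (r0 * r1 * r2 * r1 * r2) ^+ 2 = 1.

Definition nform (d e : bool) (s t : nat) : G :=
  r2 ^+ d * r0 ^+ e * (r0 * r1) ^+ s * ((r1 * r2) ^+ 2) ^+ t.

Let T := r0 * r1.
Let N := (r1 * r2) ^+ 2.

Let inv_of (x : G) (xx : x * x = 1) : x^-1 = x := mulg1_eq xx.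

Lemma r0r2C : commute r0 r2.
Proof.
have /mulg1_eq : (r0 * r2) * (r0 * r2) = 1 by rewrite -expg2.
by rewrite invgM !inv_of // => <-.
Qed.

Lemma N_r1 : N * r1 = r1 * N^-1.
Proof.
by rewrite /N expg2 !invgM !inv_of // !mulgA.
Qed.

Lemma N_r2 : N * r2 = r2 * N^-1.
Proof.
by rewrite /N expg2 !invgM !inv_of // !mulgA r2K mul1g -(mulgA _ r2 r2) r2K mulg1.
Qed.

(** The last relator is the square of [r0 * N]; an involution of this form means that [r0] inverts
    [N]. *)
Lemma N_r0 : N * r0 = r0 * N^-1.
Proof.
have /mulg1_eq : (r0 * N) * (r0 * N) = 1.
  by rewrite -expg2 /N [X in r0 * X]expg2 !mulgA.
by rewrite invgM (inv_of r0K) => /(congr1 (fun x => r0 * x * r0));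
  rewrite !mulgA r0K mul1g -!mulgA r0K mulg1 => <-.
Qed.

Lemma NX_gen r t : N * r = r * N^-1 -> N ^+ t * r = r * N^- t.
Proof.
move=> Nr; elim: t => [|t IHt]; first by rewrite expg0 invg1 mulg1 mul1g.
by rewrite [in LHS]expgS -mulgA IHt mulgA Nr -mulgA -invgM -expgSr.
Qed.

Lemma NV_gen r : N * r = r * N^-1 -> N^-1 * r = r * N.
Proof.
move=> Nr; have := Nr.
move/(congr1 (fun x => N^-1 * x * N)).
by rewrite mulKg -!mulgA mulVg mulg1 => ->.
Qed.

(** [T] is a product of two generators, each of which inverts [N]. *)
Lemma NT_comm : commute N T.
Proof.
rewrite /commute /T mulgA N_r0 -!mulgA; congr (_ * _).
exact/NV_gen/N_r1.
Qed.

Lemma TX_r0 s : T ^+ s * r0 = r0 * T ^- s.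
Proof.
have Tr0 : T * r0 = r0 * T^-1 by rewrite /T invgM !inv_of // mulgA.
elim: s => [|s IHs]; first by rewrite expg0 invg1 mulg1 mul1g.
by rewrite [in LHS]expgS -mulgA IHs mulgA Tr0 -mulgA -invgM -expgSr.
Qed.

(** For s = 1, the right side is r2 r0 r1 r1 r2 r1 r2 = r2 r0 r2 r1 r2 = r0 r1 r2, since [r0] and
    [r2] commute. Iterating gives [(T * N) ^+ s], which splits because [T] and [N] commute. *)
Lemma TX_r2 s : T ^+ s * r2 = r2 * T ^+ s * N ^+ s.
Proof.
rewrite -mulgA -expgMn; last exact/commute_sym/NT_comm.
have Tr2 : T * r2 = r2 * (T * N).
  rewrite /T /N expg2 !mulgA -r0r2C -(mulgA _ r1 r1) r1K mulg1.
  by rewrite -(mulgA _ r2 r2) r2K mulg1.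
elim: s => [|s IHs]; first by rewrite expg0 mulg1 mul1g.
by rewrite [in LHS]expgSr -mulgA Tr2 mulgA IHs -mulgA -expgSr.
Qed.

Lemma exp_red (x : G) n k : x ^+ n.+1 = 1 -> x ^+ k = x ^+ (k %% n.+1).
Proof.
by move=> xn; rewrite {1}(divn_eq k n.+1) expgnDr mulnC expgnA xn expg1n mul1g.
Qed.

Lemma exp_opp (x : G) n k : x ^+ n.+1 = 1 -> exists k', x ^- k = x ^+ k'.
Proof.
(* The sum [n * k + k] is a multiple of [n.+1]. *)
move=> xn; exists (n * k)%N; apply: mulg1_eq.
by rewrite -expgnDr -mulSn expgnA xn expg1n.
Qed.

Definition is_nform (g : G) :=
  exists d e s t, [/\ s < p.+1, t < m.+1 & g = nform d e s t].

Lemma nform_is_nform (d e : bool) s t :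
  is_nform (r2 ^+ d * r0 ^+ e * T ^+ s * N ^+ t).
Proof.
have Nm : N ^+ m.+1 = 1 by rewrite /N -expgnA mul2n.
exists d, e, (s %% p.+1), (t %% m.+1); split; rewrite ?ltn_pmod //.
by rewrite /nform -!exp_red.
Qed.

Lemma is_nform1 : is_nform 1.
Proof. by have := nform_is_nform false false 0 0; rewrite !expg0 !mulg1. Qed.

(** Moving left, [r0] inverts the powers of [N] and of [T], then merges with [r0 ^+ e]. *)
Lemma is_nform_r0 g : is_nform g -> is_nform (g * r0).
Proof.
case=> d [e [s [t [_ _ ->]]]]; rewrite /nform -!mulgA.
have Nm : N ^+ m.+1 = 1 by rewrite /N -expgnA mul2n.
rewrite (NX_gen _ N_r0) (mulgA _ r0) TX_r0.
have [s' ->] := exp_opp s sp; have [t' ->] := exp_opp t Nm.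
have -> : r0 ^+ e * (r0 * T ^+ s' * N ^+ t') = r0 ^+ (~~ e) * (T ^+ s' * N ^+ t').
  by rewrite !mulgA; case: e; rewrite ?expg1 ?expg0 ?r0K ?mul1g.
rewrite !mulgA; exact: nform_is_nform.
Qed.

Lemma is_nform_T g : is_nform g -> is_nform (g * T).
Proof.
case=> d [e [s [t [_ _ ->]]]]; rewrite /nform -mulgA.
have -> : N ^+ t * T = T * N ^+ t by apply/commute_sym/commuteX/commute_sym/NT_comm.
rewrite mulgA -(mulgA _ (T ^+ s)) -expgSr; exact: nform_is_nform.
Qed.

(** As [r0] is an involution, [r1] is [r0 * T]. *)
Lemma is_nform_r1 g : is_nform g -> is_nform (g * r1).
Proof.
move/is_nform_r0/is_nform_T.
by rewrite /T mulgA -(mulgA g) r0K mulg1.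
Qed.

(** Moving left, [r2] inverts the power of [N], leaves a factor [N ^+ s] when it passes [T ^+ s],
    and commutes with [r0 ^+ e]. *)
Lemma is_nform_r2 g : is_nform g -> is_nform (g * r2).
Proof.
case=> d [e [s [t [_ _ ->]]]]; rewrite /nform -!mulgA.
have Nm : N ^+ m.+1 = 1 by rewrite /N -expgnA mul2n.
rewrite (NX_gen _ N_r2) (mulgA _ r2) TX_r2.
have [t' ->] := exp_opp t Nm.
have -> : r2 ^+ d * (r0 ^+ e * (r2 * T ^+ s * N ^+ s * N ^+ t')) =
          r2 ^+ (~~ d) * r0 ^+ e * T ^+ s * N ^+ (s + t').
  rewrite expgnDr !mulgA; congr (_ * _ * _ * _).
  have -> : r2 ^+ d * r0 ^+ e * r2 = r2 ^+ d * r2 * r0 ^+ e.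
    by rewrite -!mulgA; congr (_ * _); apply/commute_sym/commuteX/commute_sym/r0r2C.
  by case: d; rewrite ?expg1 ?expg0 ?r2K ?mul1g.
exact: nform_is_nform.
Qed.

End NormalForm.

(** * The face poset and its flags *)

(* [Zmod n] is Z/(n+1), as a ring which may be trivial: m = 1 does occur in
   Z/m, and ['I_1] carries no ring structure in the library. *)
Definition Zmod (n : nat) : Type := 'I_n.+1.
HB.instance Definition _ n := Finite.on (Zmod n).
HB.instance Definition _ n := GRing.Zmodule.on (Zmod n).
HB.instance Definition _ n := GRing.Zmodule_isComPzRing.Build (Zmod n)
  (@Zp_mulA _) (@Zp_mulC _) (@Zp_mul1z _) (@Zp_mul_addl _).

(* Here, as in [nform], [p] and [m] are the predecessors of the numbers of the
   introduction: the type is {p+1, 2(m+1)}. *)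
Inductive tface (p m : nat) :=
  | Bot
  | Vert of Zmod p
  | Edge of Zmod p & Zmod m
  | Face of Zmod m & bool
  | Top.

Arguments Bot {p m}.
Arguments Vert {p m}.
Arguments Edge {p m}.
Arguments Face {p m}.
Arguments Top {p m}.

Section FacePoset.
Variables p m : nat.
Local Notation T := (tface p m).
Local Open Scope ring_scope.

Definition tface_code (x : T) :
    (bool + Zmod p) + (Zmod p * Zmod m + Zmod m * bool) :=
  match x with
  | Bot => inl (inl false)
  | Vert i => inl (inr i)
  | Edge i a => inr (inl (i, a))
  | Face c k => inr (inr (c, k))
  | Top => inl (inl true)
  end.

Definition tface_decode y : T :=
  match y with
  | inl (inl b) => if b then Top else Bot
  | inl (inr i) => Vert i
  | inr (inl (i, a)) => Edge i a
  | inr (inr (c, k)) => Face c k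
  end.

Lemma tface_codeK : cancel tface_code tface_decode.
Proof. by case. Qed.

HB.instance Definition _ := Finite.copy T (can_type tface_codeK).

Definition proj (i : Zmod p) : Zmod m := inZp i.

(** This is the offset in the incidence relation: the edge (i, a) lies on the 2-face
    ([a + shift k i], k). *)
Definition shift (k : bool) (i : Zmod p) : Zmod m := if k then proj i else 0.

Definition tle (x y : T) : bool :=
  match x, y with
  | Bot, _ => true
  | _, Top => true
  | Vert i, Vert j => i == j
  | Vert i, Edge j _ => (i == j) || (i == j + 1)
  | Vert _, Face _ _ => true
  | Edge i a, Edge j b => (i == j) && (a == b)
  | Edge i a, Face c k => c == a + shift k i
  | Face c k, Face c' k' => (c == c') && (k == k')
  | _, _ => false
  end.

Definition trank (x : T) : nat :=
  match x with Bot => 0 | Vert _ => 1 | Edge _ _ => 2 | Face _ _ => 3 | Top => 4 end.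

Lemma tle_refl : reflexive tle.
Proof. by case=> //= *; rewrite !eqxx. Qed.

Lemma tle_trank x y : tle x y -> (trank x <= trank y)%N.
Proof. by case: x y => [|i|i a|c k|] []. Qed.

Lemma tle_trank_eq x y : tle x y -> trank x = trank y -> x = y.
Proof.
by case: x y => [|i|i a|c k|] [|j|j b|d l|] //= =>
  [/eqP->|/andP[/eqP-> /eqP->]|/andP[/eqP-> /eqP->]].
Qed.

Lemma tle_anti : antisymmetric tle.
Proof.
move=> x y /andP[xy yx]; apply: tle_trank_eq (xy) _.
by apply/eqP; rewrite eqn_leq !tle_trank.
Qed.

(** The only chain of three distinct ranks avoiding [Bot] and [Top] is vertex, edge, 2-face, and
    every vertex lies on every 2-face. *)
Lemma tle_trans : transitive tle.
Proof.
case=> [|j|j b|d l|] [|i|i a|c k|] [|n|n e|f o|] //=;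
  first [by move/eqP-> | by case/andP=> /eqP-> /eqP-> | by move=> ij /andP[/eqP<-]
        | by move=> ij /andP[/eqP<- /eqP<-] | by []].
Qed.

HB.instance Definition _ := Order.Le_isPOrder.Build (Order.Disp tt tt) T
  tle_refl tle_anti tle_trans.
Lemma tle0x (x : T) : (Bot <= x)%O. Proof. by []. Qed.
Lemma tlex1 (x : T) : (x <= Top)%O. Proof. by case: x. Qed.
HB.instance Definition _ := Order.hasBottom.Build _ T tle0x.
HB.instance Definition _ := Order.hasTop.Build _ T tlex1.

Lemma tleE (x y : T) : (x <= y)%O = tle x y. Proof. by []. Qed.

Lemma tltE (x y : T) : (x < y)%O = (trank x < trank y)%N && tle x y.
Proof.
rewrite lt_neqAle tleE andbC; case xy: (tle x y); rewrite ?andbF ?andbT //=.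
rewrite ltn_neqAle tle_trank // andbT; congr negb.
by apply/eqP/eqP => [->|/tle_trank_eq->].
Qed.

Lemma trank_gap (x y : T) : (x < y)%O -> ((trank x).+1 < trank y)%N ->
  exists z, (x < z < y)%O.
Proof.
case: x y => [|i|i a|c k|] [|j|j b|d l|] // xy _.
- by exists (Vert j); rewrite !tltE /= eqxx.
- by exists (Vert 0).
- by exists (Vert 0).
(* The second coordinate is solved from the incidence with the 2-face (d, l). *)
- by exists (Edge i (d - shift l i)); rewrite !tltE /= eqxx subrK eqxx.
- by exists (Edge i 0); rewrite !tltE /= eqxx.
- by exists (Face a false); rewrite !tltE /= addr0 eqxx.
Qed.

(* ((i, a), (e, d)) stands for the flag with edge (i, a), vertex i + e, and the
   2-face of kind d on that edge. *)
Definition flagix : Type := (Zmod p * Zmod m) * (bool * bool).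
HB.instance Definition _ := Finite.on flagix.

Definition flag_vert (x : flagix) : T := Vert (x.1.1 + x.2.1%:R).
Definition flag_edge (x : flagix) : T := Edge x.1.1 x.1.2.
Definition flag_face (x : flagix) : T := Face (x.1.2 + shift x.2.2 x.1.1) x.2.2.
Definition mkflag (x : flagix) : {set T} :=
  [set y in [:: Bot; flag_vert x; flag_edge x; flag_face x; Top]].

Lemma mkflag_sorted x :
  sorted <%O [:: Bot; flag_vert x; flag_edge x; flag_face x; Top].
Proof.
rewrite /= !tltE /= eqxx !andbT.
by case: x => -[i a] [[] []] /=; rewrite ?addr0 ?eqxx ?orbT.
Qed.

Lemma card_mkflag x : #|mkflag x| = 5.
Proof.
rewrite cardsE; apply: (@card_uniqP _ [:: _; _; _; _; _]).
exact: lt_sorted_uniq (mkflag_sorted x).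
Qed.

Lemma mkflag_chain x : is_chain (mkflag x).
Proof.
have := mkflag_sorted x; set s := [:: _; _; _; _; _] => s_lt.
have s_le : pairwise <=%O s.
  rewrite -le_sorted_pairwise.
  by apply: sub_sorted s_lt => y z; apply: ltW.
have /allrelP s_cmp : all2rel (fun x y : T => (x >=< y)%O) s.
  rewrite -pairwise_all2rel.
  - by apply: sub_pairwise s_le => y z; apply: le_comparable.
  - by move=> y; apply: comparablexx.
  - by move=> y z; apply: comparable_sym.
apply/forall_inP => y; rewrite inE => ys; apply/forall_inP => z; rewrite inE => zs.
exact: s_cmp.
Qed.

Lemma chain_sub_mkflag (C : {set T}) : is_chain C -> exists x, C \subset mkflag x.
Proof.
move=> /forall_inP chC.
have cmp y z : y \in C -> z \in C -> tle y z || tle z y.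
  by move=> yC zC; have /forall_inP/(_ z zC) := chC y yC.
case: (pickP [pred e : Zmod p * Zmod m | Edge e.1 e.2 \in C]) => [[i a] /= eC | noE].
  (* Each bit is set exactly when the chain contains the second of the two candidates; a chain
     containing neither gets the first one. *)
  exists ((i, a), (Vert (i + 1) \in C, Face (a + proj i) true \in C)).
  apply/subsetP => -[|j|j b|c k|] yC; rewrite !inE ?eqxx ?orbT //.
  - suff -> : j = i + (Vert (i + 1) \in C)%:R by rewrite eqxx ?orbT.
    case: (boolP (Vert (i + 1) \in C)) => vC.
      by have := cmp _ _ yC vC => /orP[/eqP|/eqP].
    rewrite addr0; have := cmp _ _ yC eC => /=.
    rewrite orbF => /orP[/eqP //|/eqP jE].
    by rewrite jE (negPf vC) in yC.
  - have := cmp _ _ yC eC => /= /orP[/andP[/eqP-> /eqP->]|/andP[/eqP-> /eqP->]];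
    by rewrite eqxx ?orbT.
  - suff -> : Face c k =
        flag_face ((i, a), (Vert (i + 1) \in C, Face (a + proj i) true \in C)).
      by rewrite eqxx !orbT.
    rewrite /flag_face /=; case: (boolP (Face (a + proj i) true \in C)) => fC.
      by have := cmp _ _ yC fC => /= /orP[/andP[/eqP-> /eqP->]|/andP[/eqP-> /eqP->]].
    have := cmp _ _ yC eC => /= /eqP cE; rewrite {}cE in yC *.
    by case: k yC fC => //= ->.
(* Without an edge in the chain, a missing vertex or 2-face is chosen arbitrarily; the two are
   always incident, and an edge incident with both completes the flag. *)
pose i := odflt 0 [pick i | Vert i \in C].
pose f := odflt (0, false) [pick f | Face f.1 f.2 \in C].
exists ((i, f.1 - shift f.2 i), (false, f.2)).
apply/subsetP => -[|j|j b|c k|] yC; rewrite !inE ?eqxx ?orbT //.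
- suff -> : j = i by rewrite /flag_vert /= addr0 eqxx ?orbT.
  rewrite /i; case: pickP => [i' iC|/(_ j)]; last by rewrite yC.
  by have := cmp _ _ yC iC => /orP[/eqP|/eqP].
- by have := noE (j, b); rewrite /= yC.
- suff [-> ->] : c = f.1 /\ k = f.2 by rewrite /flag_face /= subrK eqxx ?orbT.
  rewrite /f; case: pickP => [f' fC|/(_ (c, k))]; last by rewrite yC.
  by have := cmp _ _ yC fC => /= /orP[/andP[/eqP-> /eqP->]|/andP[/eqP-> /eqP->]].
Qed.

(** Every chain extends to some [mkflag x], and all these sets have five faces, so none is properly
    contained in another chain. *)
Lemma is_flagP (F : {set T}) : reflect (exists x, F = mkflag x) (is_flag F).
Proof.
apply: (iffP maxsetP) => [[chF maxF]|[x ->]].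
  have [x Fx] := chain_sub_mkflag chF; exists x.
  by rewrite -(maxF _ (mkflag_chain x) Fx).
split=> [|C chC xC]; first exact: mkflag_chain.
have [y Cy] := chain_sub_mkflag chC; apply/eqP; rewrite eq_sym eqEcard xC.
apply: leq_trans (subset_leq_card Cy) _.
by rewrite [X in (X <= _)%N]card_mkflag [X in (_ <= X)%N]card_mkflag.
Qed.

Lemma mem_mkflag_edge i a x : (Edge i a \in mkflag x) = (x.1 == (i, a)).
Proof.
rewrite !inE /= ?orbF.
by case: x => -[j b] x2; apply/eqP/eqP => [[-> ->]|[-> ->]].
Qed.

Lemma mem_mkflag_vert i x : (Vert i \in mkflag x) = (i == x.1.1 + x.2.1%:R).
Proof. by rewrite !inE /= ?orbF; apply/eqP/eqP => [[->]|->]. Qed.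

Lemma mem_mkflag_face c k x :
  (Face c k \in mkflag x) = (c == x.1.2 + shift k x.1.1) && (k == x.2.2).
Proof.
rewrite !inE /= ?orbF; apply/eqP/andP => [[-> ->]|[/eqP-> /eqP->] //].
by rewrite !eqxx.
Qed.

Hypothesis p_gt0 : (0 < p)%N.

Lemma one_neq0 : (1 != 0 :> Zmod p).
Proof. by rewrite -val_eqE /= modn_small ?ltnS. Qed.

(** The vertex determines the first bit because the ends i and i + 1 of an edge differ; the second
    bit is the kind of the 2-face. *)
Lemma mkflag_inj : injective mkflag.
Proof.
move=> x y xy.
have : flag_edge x \in mkflag y by rewrite -xy !inE eqxx !orbT.
rewrite mem_mkflag_edge => /eqP xy1.
have : flag_face x \in mkflag y by rewrite -xy !inE eqxx !orbT.
rewrite mem_mkflag_face => /andP[_ /eqP xy22].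
have : flag_vert x \in mkflag y by rewrite -xy !inE eqxx !orbT.
rewrite mem_mkflag_vert xy1 /= (inj_eq (addrI _)) => /eqP xy21.
case: x y xy1 xy21 xy22 {xy} => [[i a] [e d]] [[j b] [e' d']] /= [-> ->] ee ->.
congr (_, (_, _)); case: e e' ee => -[] //= /eqP; first by rewrite (negPf one_neq0).
by rewrite eq_sym (negPf one_neq0).
Qed.

End FacePoset.

Arguments proj {p m}.
Arguments shift {p m}.
Arguments one_neq0 {p}.

(** * Polygonal sections *)

Section PolygonSection.
Variables (disp : Order.disp_t) (T : finTBPOrderType disp) (x y : T).
Variables (k : nat) (f : polygon_face k -> T).
Hypothesis k_gt0 : 0 < k.
Hypothesis f_onto : forall z : T, (x <= z <= y)%O <-> exists u, z = f u.
Hypothesis f_mono : forall u v, (f u <= f v)%O = polygon_le u v.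
Local Open Scope order_scope.

Lemma polygon_lt u v : (f u < f v) = polygon_le u v && ~~ polygon_le v u.
Proof. by rewrite lt_leAnge !f_mono. Qed.

Lemma polygon_bounds : x = f Pempty /\ y = f Pfull.
Proof.
have in_f u : x <= f u <= y by apply/f_onto; exists u.
have /andP[xf fy] := in_f Pempty; have xy := le_trans xf fy.
have [|u xu] := (f_onto x).1; first by rewrite lexx.
have [|v yv] := (f_onto y).1; first by rewrite lexx xy.
have /andP[_ f1y] := in_f Pfull; split; apply/le_anti.
  by rewrite xf xu f_mono.
by rewrite f1y andbT yv f_mono; case: (v).
Qed.

(** A walk along the boundary reaches every vertex from vertex 0, passing from vertex i to vertex i
    + 1 through edge i; edge j is then reached from vertex j. *)
Lemma polygon_connected u v : x < u < y -> x < v < y -> section_connect x y u v.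
Proof.
have [xE yE] := polygon_bounds.
set e := [rel u v | [&& x < u < y, x < v < y & u >=< v]].
have e_sym : connect_sym e.
  by apply: sym_connect_sym => s t /=; rewrite andbCA comparable_sym.
have conn_ve i j : polygon_le (Pvertex i) (Pedge j) ->
    connect e (f (Pvertex i)) (f (Pedge j)).
  move=> ij; apply: connect1.
  by rewrite /e /= xE yE !polygon_lt /= le_comparable ?f_mono.
pose o := Ordinal k_gt0.
have conn_v (i : 'I_k) : connect e (f (Pvertex o)) (f (Pvertex i)).
  case: i => i; elim: i => [|i IHi] ik.
    by rewrite (_ : Ordinal ik = o) ?connect0 //; apply: val_inj.
  apply: connect_trans (IHi (ltnW ik)) _.
  apply: connect_trans (conn_ve _ (Ordinal (ltnW ik)) _) _; first by rewrite /= eqxx.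
  by rewrite e_sym conn_ve //= modn_small // eqxx orbT.
suff conn w : x < w < y -> connect e (f (Pvertex o)) w.
  by move=> ux vx; apply: connect_trans (conn v vx); rewrite e_sym conn.
move=> xwy; have /andP[/ltW xw /ltW wy] := xwy.
have [|t wt] := (f_onto w).1; first by rewrite xw.
move: xwy; rewrite xE yE wt !polygon_lt; case: t {wt} => //= i _.
by apply: connect_trans (conn_v i) _; apply: conn_ve; rewrite /= eqxx.
Qed.

End PolygonSection.

(** * The 2-faces and the vertex-figures as polygons *)

Section Sections.
Variables p m : nat.
Local Notation T := (tface p m).
Local Open Scope ring_scope.

Lemma val_natr n k : (k%:R : Zmod n) = (k %% n.+1)%N :> nat.
Proof. by rewrite [k%:R]Zp_mulrn /= modnMml mul1n. Qed.

Lemma natr_Zmod n (i : Zmod n) : (nat_of_ord i)%:R = i.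
Proof. by apply: val_inj; rewrite /= val_natr modn_small. Qed.

Lemma natr_modZ n k : (k %% n.+1)%:R = k%:R :> Zmod n.
Proof. by apply: val_inj; rewrite /= !val_natr modn_mod. Qed.

Lemma val_Zmod_add1 n (i : Zmod n) : (i + 1 : Zmod n) = (i.+1 %% n.+1)%N :> nat.
Proof. by rewrite /= modnDmr addn1. Qed.

(** Turns the equivalence of two incidence equations into an identity within reach of [ring]. *)
Lemma eq_subr (V : zmodType) (a b c d : V) : a - b = c - d -> (a == b) = (c == d).
Proof. by rewrite -[a == b]subr_eq0 -[c == d]subr_eq0 => ->. Qed.

(** Among the edges joining j to j + 1, exactly one lies on the 2-face (c, k): the one with second
    coordinate [c - shift k j]. *)
Definition facet_poly (c : Zmod m) (k : bool) (u : polygon_face p.+1) : T :=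
  match u with
  | Pempty => Bot
  | Pvertex i => Vert i
  | Pedge j => Edge j (c - shift k (j : Zmod p))
  | Pfull => Face c k
  end.

Lemma facet_poly_onto c k (z : T) :
  (Bot <= z <= Face c k)%O <-> exists u, z = facet_poly c k u.
Proof.
split=> [|[[|i|i|] ->]]; rewrite !tleE /= ?subrK ?eqxx //.
case: z => [|i|i a|c' k'|] //=.
- by exists Pempty.
- by exists (Pvertex i).
- by move/eqP->; exists (Pedge i); rewrite /= addrK.
- by case/andP=> /eqP-> /eqP->; exists Pfull.
Qed.

Lemma facet_poly_mono c k u v :
  (facet_poly c k u <= facet_poly c k v)%O = polygon_le u v.
Proof.
case: u v => [|i|i|] [|j|j|] //=; rewrite tleE /= ?subrK ?eqxx //.
  by congr (_ || _); rewrite -[LHS]val_eqE; congr (_ == _); apply: val_Zmod_add1.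
by case: eqP => // ->; rewrite eqxx.
Qed.

Hypothesis p_gt0 : (0 < p)%N.
Hypothesis m_dvd_p : (m.+1 %| p.+1)%N.

(** Reduction from Z/(p+1) to Z/(m+1) is additive because m + 1 divides p + 1. *)
Lemma projD : {morph @proj p m : i j / i + j}.
Proof.
move=> i j; apply: val_inj.
by rewrite /= modn_dvdm // modnDm.
Qed.

Lemma proj0 : proj (0 : Zmod p) = 0 :> Zmod m.
Proof. by apply: val_inj; rewrite /= mod0n. Qed.

Lemma projN : {morph @proj p m : i / - i}.
Proof. by move=> i; apply: (addrI (@proj p m i)); rewrite -projD !subrr proj0. Qed.

Lemma proj1 : proj (1 : Zmod p) = 1 :> Zmod m.
Proof. by apply: val_inj; rewrite /= modn_dvdm. Qed.

Definition projE := (projD, projN, proj1, proj0).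

(* The faces around the vertex i, in cyclic order: edge (i, a), 2-face
   (a + i, 1), edge (i - 1, a + 1), 2-face (a + 1, 0), edge (i, a + 1), ... *)
Definition vfig_poly (i : Zmod p) (u : polygon_face (m.+1.*2)) : T :=
  match u with
  | Pempty => Vert i
  | Pvertex x => if odd x then Edge (i - 1) (x./2%:R + 1) else Edge i x./2%:R
  | Pedge x => if odd x then Face (x./2%:R + 1) false
               else Face (x./2%:R + proj i) true
  | Pfull => Top
  end.

Lemma pred_neq (i : Zmod p) : (i - 1 == i) = false.
Proof.
by rewrite -subr_eq0 (_ : _ - i = - 1) ?oppr_eq0 ?(negPf (one_neq0 _)) //; ring.
Qed.

Lemma vfig_poly_onto i (z : T) :
  (Vert i <= z <= Top)%O <-> exists u, z = vfig_poly i u.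
Proof.
have ltd (a : Zmod m) : (a.*2 < m.+1.*2)%N by rewrite ltn_double.
have ltd1 (a : Zmod m) : (a.*2.+1 < m.+1.*2)%N by rewrite ltn_Sdouble.
(* At odd positions the coordinates have the form [x./2%:R + 1], so a given residue is first written
   as a successor. *)
have succ_onto (a : Zmod m) : exists b, a = b + 1 by exists (a - 1); rewrite subrK.
split=> [|[[|x|x|] ->]]; rewrite !tleE /= ?eqxx //; last 2 first.
- by case: odd; rewrite /= ?subrK eqxx ?orbT.
- by case: odd.
case: z => [|j|j a|c k|] //=.
- by rewrite andbT => /eqP->; exists Pempty.
- rewrite andbT => /orP[/eqP<-|/eqP->].
    exists (Pvertex (Ordinal (ltd a))).
    by rewrite /= odd_double doubleK natr_Zmod.
  have [b ->] := succ_onto a; exists (Pvertex (Ordinal (ltd1 b))).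
  by rewrite /= odd_double /= uphalf_double natr_Zmod addrK.
- move=> _; case: k.
    have [b ->] : exists b, c = b + proj i by exists (c - proj i); rewrite subrK.
    exists (Pedge (Ordinal (ltd b))).
    by rewrite /= odd_double doubleK natr_Zmod.
  have [b ->] := succ_onto c; exists (Pedge (Ordinal (ltd1 b))).
  by rewrite /= odd_double /= uphalf_double natr_Zmod.
- by exists Pfull.
Qed.

(** Halves of positions are below m + 1, so reduction modulo m + 1 loses nothing, and the parity
    restores the position. *)
Lemma eq_half (x y : 'I_(m.+1.*2)) : odd x = odd y ->
  (x./2%:R == y./2%:R :> Zmod m) = (x == y).
Proof.
have val_half (z : 'I_(m.+1.*2)) : nat_of_ord (z./2%:R : Zmod m) = z./2.
  have z2 : (z./2 < m.+1)%N.
    by rewrite -ltn_double; have := odd_double_half z; have := ltn_ord z; lia.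
  by rewrite [z./2%:R](natr_Zmod (Ordinal z2)).
move=> xy; rewrite -!val_eqE /= !val_half.
rewrite -[nat_of_ord x in RHS]odd_double_half -[nat_of_ord y in RHS]odd_double_half.
by rewrite xy eqn_add2l (inj_eq double_inj).
Qed.

(** The position after an odd y has half y/2 + 1; the wrap-around modulo 2(m+1) becomes reduction
    modulo m + 1. *)
Lemma eq_half_succ (x y : 'I_(m.+1.*2)) : ~~ odd x -> odd y ->
  (y./2%:R + 1 == x./2%:R :> Zmod m) = (x == y.+1 %% m.+1.*2 :> nat)%N.
Proof.
move=> xe yo; have y1 : (y.+1 %% m.+1.*2 < m.+1.*2)%N by rewrite ltn_mod.
have yE : y.+1 = (2 * (y./2).+1)%N by have := odd_double_half y; lia.
have mod2 a : (2 * a %% m.+1.*2 = 2 * (a %% m.+1))%N by rewrite -mul2n muln_modr.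
have y1E : (y.+1 %% m.+1.*2 = 2 * ((y./2).+1 %% m.+1))%N by rewrite yE mod2.
rewrite -[RHS]/(x == Ordinal y1) -eq_half; last first.
  by rewrite /= y1E mul2n odd_double (negPf xe).
rewrite eq_sym /= y1E mul2n doubleK; congr (_ == _).
by rewrite natr_modZ mulrSr.
Qed.

Lemma vfig_vertex_vertex i (x y : 'I_(m.+1.*2)) :
  tle (vfig_poly i (Pvertex x)) (vfig_poly i (Pvertex y)) = (x == y).
Proof.
have [xy|xy] := eqVneq (odd x) (odd y).
  rewrite /vfig_poly -eq_half // -xy; case: (odd x); rewrite /tle eqxx andTb //.
  by rewrite (inj_eq (addIr 1)).
have -> : (x == y) = false by apply: contraNF xy => /eqP->.
rewrite /vfig_poly; case: (odd x) (odd y) xy => -[] // _; rewrite /tle.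
  by rewrite pred_neq.
by rewrite eq_sym pred_neq.
Qed.

(** Since 2(m+1) is even, equal parities leave only [x == y] possible, and different parities only
    the cyclic successor. *)
Lemma vfig_vertex_edge i (x y : 'I_(m.+1.*2)) :
  tle (vfig_poly i (Pvertex x)) (vfig_poly i (Pedge y)) =
  (x == y :> nat)%N || (x == y.+1 %% m.+1.*2 :> nat)%N.
Proof.
have odd_mod (k : nat) : odd (k %% m.+1.*2) = odd k.
  by rewrite {2}(divn_eq k m.+1.*2) oddD oddM odd_double andbF.
have [xy|xy] := eqVneq (odd x) (odd y).
  rewrite [X in _ || X](_ : _ = false) ?orbF; last first.
    by apply: contra_eqF xy => /eqP->; rewrite odd_mod /=; case: odd.
  rewrite -[RHS]/(x == y) -eq_half // eq_sym /vfig_poly -xy; case: (odd x).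
    by rewrite /tle /shift addr0 (inj_eq (addIr _)).
  by rewrite /tle /shift (inj_eq (addIr _)).
rewrite [X in X || _](_ : _ = false) ?orFb; last by apply: contraNF xy => /eqP->.
rewrite /vfig_poly; case xo: (odd x) xy; case yo: (odd y) => // _;
  rewrite /tle /shift; last first.
  by rewrite addr0 eq_half_succ ?xo.
(* The last position is odd, so the successor of an even y does not wrap around. *)
have yx : (y.+1 < m.+1.*2)%N.
  rewrite ltn_neqAle ltn_ord andbT; apply: contraFN yo => /eqP/(congr1 odd).
  by rewrite odd_double /= => /negbFE.
rewrite modn_small // -[RHS]/(x == Ordinal yx) -eq_half ?xo /= ?yo //.
rewrite uphalf_half yo add0n eq_sym; apply: eq_subr.
by rewrite !projE; ring.
Qed.

Lemma vfig_edge_edge i (x y : 'I_(m.+1.*2)) :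
  tle (vfig_poly i (Pedge x)) (vfig_poly i (Pedge y)) = (x == y).
Proof.
have [xy|xy] := eqVneq (odd x) (odd y).
  by rewrite /vfig_poly -eq_half // -xy; case: (odd x);
    rewrite /tle eqxx andbT (inj_eq (addIr _)).
have -> : (x == y) = false by apply: contraNF xy => /eqP->.
by rewrite /vfig_poly; case: (odd x) (odd y) xy => -[] // _; rewrite /tle andbF.
Qed.

Lemma vfig_poly_mono i u v :
  (vfig_poly i u <= vfig_poly i v)%O = polygon_le u v.
Proof.
rewrite tleE; case: u v => [|x|x|] [|y|y|]; rewrite /polygon_le.
- exact: tle_refl.
- by rewrite /=; case: odd; rewrite /tle ?subrK eqxx ?orbT.
- by rewrite /=; case: odd.
- by [].
- by rewrite /=; case: odd.
- exact: vfig_vertex_vertex.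
- exact: vfig_vertex_edge.
- by rewrite /=; case: odd.
- by rewrite /=; case: odd.
- by rewrite /=; case: (odd x) (odd y) => -[].
- exact: vfig_edge_edge.
- by rewrite /=; case: odd.
- by [].
- by rewrite /=; case: odd.
- by rewrite /=; case: odd.
- by [].
Qed.

End Sections.

(** * The polyhedron *)

Section TightPolyhedron.
Variables p m : nat.
Local Notation T := (tface p m).
Hypothesis p_gt0 : (0 < p)%N.
Hypothesis m_dvd_p : (m.+1 %| p.+1)%N.
Local Open Scope ring_scope.

Definition face_rank (x : T) : int := (trank x)%:Z - 1.

Lemma face_rank_cover (x y : T) :
  (x < y)%O -> (forall z, ~~ (x < z < y)%O) -> face_rank y = face_rank x + 1.
Proof.
move=> xy no_z; have := xy; rewrite tltE => /andP[rxy _].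
have [gap|] := ltnP (trank x).+1 (trank y).
  by have [z xzy] := trank_gap xy gap; have := no_z z; rewrite xzy.
by rewrite /face_rank; lia.
Qed.

Lemma card_flag_tface (F : {set T}) : is_flag F -> #|F| = (3 + 2)%N.
Proof. by case/is_flagP=> x ->; rewrite card_mkflag. Qed.

Lemma tface_sections_connected (x y : T) :
  (x <= y)%O -> 2 <= face_rank y - face_rank x - 1 ->
  forall u v, (x < u < y)%O -> (x < v < y)%O -> section_connect x y u v.
Proof.
rewrite /face_rank => xy rxy.
(* A rank difference of at least 3 leaves three sorts of section: below a 2-face, the whole poset,
   and above a vertex. *)
case: x y xy rxy => [|i|i a|c k|] [|j|j b|d l|] //= _; rewrite ?subrr // => _.
- by apply: polygon_connected (facet_poly_onto d l) (facet_poly_mono d l).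
- move=> u v.
  set e := [rel u v : T |
    [&& (Bot < u < Top)%O, (Bot < v < Top)%O & (u >=< v)%O]].
  have e_sym : connect_sym e.
    by apply: sym_connect_sym => s t /=; rewrite andbCA comparable_sym.
  have conn1 (s t : T) : (Bot < s)%O -> (s <= t)%O -> (t < Top)%O -> connect e s t.
    move=> s0 st t1; apply: connect1.
    by rewrite /= s0 t1 (le_lt_trans st) // (lt_le_trans s0) // le_comparable.
  (* A single 2-face reaches all vertices, and every other proper face contains some vertex. *)
  have conn_v i : connect e (Face 0 false) (Vert i).
    by rewrite e_sym conn1 ?tltE.
  suff conn w : (Bot < w < Top)%O -> connect e (Face 0 false) w.
    by move=> /conn cu /conn cv; apply: connect_trans cv; rewrite e_sym.
  case: w => [|i|i a|c k|] // _.
    apply: connect_trans (conn_v i) _; apply: conn1; rewrite ?tltE //.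
    by rewrite tleE /= eqxx.
  by apply: connect_trans (conn_v 0) _; apply: conn1; rewrite ?tltE.
- by apply: polygon_connected (vfig_poly_onto i) (vfig_poly_mono p_gt0 m_dvd_p i).
Qed.

(** The three cases are the two ends of an edge, the two edges at a vertex within a 2-face, and the
    two 2-faces on an edge. Besides the diamond condition, this serves to propagate fixed faces of
    an automorphism. *)
Lemma between2 (x y : T) : (x <= y)%O -> trank y = (trank x).+2 ->
  exists z z', [/\ z != z', (x < z < y)%O, (x < z' < y)%O &
    forall w, (x < w < y)%O -> w = z \/ w = z'].
Proof.
case: x y => [|i|i a|c k|] [|j|j b|d l|] // xy _.
- exists (Vert j), (Vert (j + 1)); split.
  + apply/eqP => -[/eqP]; rewrite -subr_eq0 opprD addNKr oppr_eq0.
    exact/negP/one_neq0.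
  + by rewrite !tltE /tle eqxx.
  + by rewrite !tltE /tle eqxx orbT.
  + by case=> [|n|n e|c k|]; rewrite !tltE ?andbF //= => /orP[/eqP->|/eqP->];
    [left|right].
- exists (Edge i (d - shift l i)), (Edge (i - 1) (d - shift l (i - 1))); split.
  + by apply/eqP => -[/eqP]; rewrite eq_sym pred_neq.
  + by rewrite !tltE /tle subrK !eqxx.
  + by rewrite !tltE /tle !subrK !eqxx orbT.
  + case=> [|n|n e|c k|]; rewrite !tltE ?andbF //.
    rewrite /tle => /andP[/= /orP[/eqP->|/eqP->] /eqP->]; [left|right];
    by rewrite ?addrK.
- exists (Face a false), (Face (a + proj i) true); split.
  + apply/eqP; discriminate.
  + by rewrite !tltE /tle /shift addr0 eqxx.
  + by rewrite !tltE /tle eqxx.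
  + case=> [|n|n e|c []|]; rewrite !tltE ?andbF // /tle /shift =>
      /andP[/andP[_ /eqP->] _];
    [by right | by left; rewrite addr0].
Qed.

Lemma diamond_tface (j : int) (x y : T) :
  face_rank x = j - 1 -> face_rank y = j + 1 -> (x <= y)%O ->
  #|[set z : T | (face_rank z == j) && (x <= z <= y)%O]| = 2%N.
Proof.
rewrite /face_rank => xj yj xy.
have xy2 : trank y = (trank x).+2 by lia.
have [z [z' [zz' xzy xz'y only]]] := between2 xy xy2.
have -> : 2%N = #|[set z; z']| by rewrite cards2 zz'.
apply: eq_card => w; rewrite !inE.
have -> : ((trank w)%:Z - 1 == j) && (x <= w <= y)%O = (x < w < y)%O.
  have -> : ((trank w)%:Z - 1 == j) = (trank w == (trank x).+1) by lia.
  rewrite !tltE !tleE xy2 ltnS; case: (tle x w); rewrite ?andbF //= andbT.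
  by case: (tle w y); rewrite ?andbF // !andbT andbC -eqn_leq.
apply/idP/orP => [/only[->|->]|[/eqP->|/eqP->] //]; by [left | right].
Qed.

Definition tight_polytope : polyhedron :=
  @Polytope 3 _ T face_rank erefl erefl face_rank_cover card_flag_tface
    tface_sections_connected diamond_tface.

Lemma tight_polytope_type : has_type tight_polytope p.+1 m.+1.*2.
Proof.
split=> [] [|i|i a|c k|] //= _.
  exists (facet_poly c k).
  by split=> [z|u v]; [apply: facet_poly_onto | apply: facet_poly_mono].
exists (vfig_poly i).
by split=> [z|u v]; [apply: vfig_poly_onto | apply: vfig_poly_mono].
Qed.

Lemma flagsP (F : {set tight_polytope}) :
  reflect (exists x : flagix p m, F = mkflag x) (F \in flags tight_polytope).
Proof. by rewrite inE; apply: is_flagP. Qed.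

Lemma tight_polytope_tight : tight tight_polytope p.+1 m.+1.*2.
Proof.
rewrite /tight.
have -> : flags tight_polytope = [set mkflag x | x : flagix p m].
  apply/setP => F; apply/flagsP/imsetP => [[x ->]|[x _ ->]]; by exists x.
rewrite card_imset; last exact: mkflag_inj.
by rewrite !card_prod !card_bool !card_ord -!muln2; lia.
Qed.

End TightPolyhedron.

(** * Reflections *)

Section Symmetries.
Variables p m : nat.
Local Notation T := (tface p m).
Hypothesis p_gt0 : (0 < p)%N.
Hypothesis m_dvd_p : (m.+1 %| p.+1)%N.
Local Open Scope ring_scope.

(* The reflections in the base flag: vertex 0, edge (0, 0), 2-face (0, 0). *)
Definition sym0 (x : T) : T :=
  match x with
  | Vert i => Vert (1 - i)
  | Edge i a => Edge (- i) (- a)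
  | Face c k => Face (- c) k
  | _ => x
  end.

(** The term [k%:R] is forced: the edge (i, a) goes to (-i - 1, -a), whose 2-face of kind 1 has
    first coordinate -(a + i) - 1. *)
Definition sym1 (x : T) : T :=
  match x with
  | Vert i => Vert (- i)
  | Edge i a => Edge (- i - 1) (- a)
  | Face c k => Face (- c - k%:R) k
  | _ => x
  end.

(** Exchanging the kinds sends the 2-faces (a, 0) and (a + i, 1) on the edge (i, a) to (-a, 1) and
    (-a - i, 0), the 2-faces on (i, -a - i). *)
Definition sym2 (x : T) : T :=
  match x with
  | Edge i a => Edge i (- a - proj i)
  | Face c k => Face (- c) (~~ k)
  | _ => x
  end.

Lemma sym0K : involutive sym0.
Proof. by case=> //= [i|i a|c k]; rewrite ?opprK // subKr. Qed.

Lemma sym1K : involutive sym1.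
Proof.
case=> [|i|i a|c k|] //; rewrite /sym1 ?opprK //.
  by congr Edge; ring.
by congr Face; ring.
Qed.

Lemma sym2K : involutive sym2.
Proof.
case=> [|i|i a|c k|] //; rewrite /sym2 ?opprK ?negbK //.
by congr Edge; ring.
Qed.

(** The reflections negate most of the differences to be compared, hence this variant of [eq_subr]
    up to sign. *)
Let eq_flip (V : comPzRingType) (a b c d : V) : a - b = d - c -> (a == b) = (c == d).
Proof. by rewrite [c == d]eq_sym; apply: eq_subr. Qed.

Let projE := projE m_dvd_p.

Lemma sym0_mono x y : tle (sym0 x) (sym0 y) = tle x y.
Proof.
case: x y => [|i|i a|c k|] [|j|j b|d l|] //; rewrite /sym0 /tle.
- by apply: eq_flip; ring.
- by rewrite orbC; congr (_ || _); apply: eq_flip; ring.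
- by congr (_ && _); apply: eq_flip; ring.
- by apply: eq_flip; case: l; rewrite /shift /= ?projE; ring.
- by congr (_ && _); apply: eq_flip; ring.
Qed.

Lemma sym1_mono x y : tle (sym1 x) (sym1 y) = tle x y.
Proof.
case: x y => [|i|i a|c k|] [|j|j b|d l|] //; rewrite /sym1 /tle.
- by apply: eq_flip; ring.
- by rewrite orbC; congr (_ || _); apply: eq_flip; ring.
- by congr (_ && _); apply: eq_flip; ring.
- by apply: eq_flip; case: l; rewrite /shift /= ?projE; ring.
- rewrite andbC [RHS]andbC; case: (k =P l) => [->|] //=.
  by apply: eq_flip; ring.
Qed.

Lemma sym2_mono x y : tle (sym2 x) (sym2 y) = tle x y.
Proof.
case: x y => [|i|i a|c k|] [|j|j b|d l|] //; rewrite /sym2 /tle.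
- case: (i =P j) => [->|] //=; by apply: eq_flip; ring.
- by apply: eq_flip; case: l; rewrite /shift /= ?projE; ring.
- congr (_ && _); last by case: (k) (l) => -[].
  by apply: eq_flip; ring.
Qed.

Local Notation P := (tight_polytope p_gt0 m_dvd_p).

Definition refl0 : {perm P} := perm (inv_inj sym0K : injective (sym0 : P -> P)).
Definition refl1 : {perm P} := perm (inv_inj sym1K : injective (sym1 : P -> P)).
Definition refl2 : {perm P} := perm (inv_inj sym2K : injective (sym2 : P -> P)).

Lemma refl0_aut : refl0 \in automs P.
Proof. by apply/automsP => x y; rewrite !permE; apply: sym0_mono. Qed.

Lemma refl1_aut : refl1 \in automs P.
Proof. by apply/automsP => x y; rewrite !permE; apply: sym1_mono. Qed.

Lemma refl2_aut : refl2 \in automs P.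
Proof. by apply/automsP => x y; rewrite !permE; apply: sym2_mono. Qed.

Definition flag0 (x : flagix p m) : flagix p m :=
  ((- x.1.1, - x.1.2), (~~ x.2.1, x.2.2)).
Definition flag1 (x : flagix p m) : flagix p m :=
  ((- x.1.1 - 1, - x.1.2), (~~ x.2.1, x.2.2)).
Definition flag2 (x : flagix p m) : flagix p m :=
  ((x.1.1, - x.1.2 - proj x.1.1), (x.2.1, ~~ x.2.2)).

Lemma setact_mkflag (s : {perm P}) (x y : flagix p m) :
  s Bot = Bot -> s Top = Top -> s (flag_vert x) = flag_vert y ->
  s (flag_edge x) = flag_edge y -> s (flag_face x) = flag_face y ->
  ('P^*)%act (mkflag x : {set P}) s = mkflag y.
Proof.
move=> s0 s1 sv se sf.
have -> : mkflag y =
    [set z in map s [:: Bot; flag_vert x; flag_edge x; flag_face x; Top]].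
  by rewrite /= s0 s1 sv se sf.
apply/setP => z; rewrite [in RHS]inE; apply/imsetP/mapP => -[w].
  by rewrite inE => wx ->; exists w.
by move=> wx ->; exists w; rewrite // in_set.
Qed.

Lemma refl0_flag x : ('P^*)%act (mkflag x : {set P}) refl0 = mkflag (flag0 x).
Proof.
apply: setact_mkflag; rewrite permE //; case: x => -[i a] [e d].
  by congr Vert; case: e => /=; ring.
by congr Face; case: d; rewrite /shift /= ?projE; ring.
Qed.

Lemma refl1_flag x : ('P^*)%act (mkflag x : {set P}) refl1 = mkflag (flag1 x).
Proof.
apply: setact_mkflag; rewrite permE //; case: x => -[i a] [e d].
  by congr Vert; case: e => /=; ring.
by congr Face; case: d; rewrite /shift /= ?projE; ring.
Qed.

Lemma refl2_flag x : ('P^*)%act (mkflag x : {set P}) refl2 = mkflag (flag2 x).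
Proof.
apply: setact_mkflag; rewrite permE //; case: x => -[i a] [e d].
by congr Face; case: d; rewrite /shift /= ?projE; ring.
Qed.

End Symmetries.

(** * Automorphisms fixing a flag *)

Section FlagAction.
Variables p m : nat.
Local Notation T := (tface p m).
Hypothesis p_gt0 : (0 < p)%N.
Hypothesis m_dvd_p : (m.+1 %| p.+1)%N.
Local Open Scope ring_scope.
Local Notation P := (tight_polytope p_gt0 m_dvd_p).

Section Fixing.
Variable s : {perm P}.
Hypothesis s_aut : s \in automs P.

Let s_le (x y : T) : ((s x : T) <= s y)%O = (x <= y)%O := automsP _ s_aut x y.

Lemma aut_lt (x y : T) : ((s x : T) < s y)%O = (x < y)%O.
Proof. by rewrite !lt_leAnge !s_le. Qed.

Lemma aut_bot : s (Bot : T) = Bot.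
Proof.
apply: (@le_anti _ T); rewrite [X in _ && X]le0x andbT.
by rewrite -[X in (_ <= X)%O](permKV s) s_le le0x.
Qed.

Lemma aut_top : s (Top : T) = Top.
Proof.
apply: (@le_anti _ T); rewrite [X in X && _]lex1 /=.
by rewrite -[X in (X <= _)%O](permKV s) s_le lex1.
Qed.

(** There are exactly two faces between x and y, and [s] permutes them; fixing one, it fixes the
    other. *)
Lemma fix_between (x y z z' : T) : trank y = (trank x).+2 ->
  (x < z < y)%O -> (x < z' < y)%O -> z != z' ->
  s x = x -> s y = y -> s z = z -> s z' = z'.
Proof.
move=> xy2 xzy xz'y zz' sx sy sz.
have xy : (x <= y)%O by case/andP: xzy => /ltW xz /ltW; apply: le_trans.
have [u [u' [_ _ _ only]]] := between2 p_gt0 xy xy2.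
have sxz'y : (x < s z' < y)%O by rewrite -{1}sx -{1}sy !aut_lt.
have szz' : s z' != z by rewrite -sz (inj_eq perm_inj) eq_sym.
move: zz' szz'; case: (only _ sxz'y) => ->; case: (only _ xzy) => ->;
  by case: (only _ xz'y) => ->; rewrite ?eqxx.
Qed.

Definition fixes (x : flagix p m) :=
  [/\ s (flag_vert x) = flag_vert x, s (flag_edge x) = flag_edge x
    & s (flag_face x) = flag_face x].

(** A flag fixed as a set is fixed face by face, because [s] preserves the strict order on it. *)
Lemma fix_mkflag (x : flagix p m) :
  ('P^*)%act (mkflag x : {set P}) s = mkflag x -> fixes x.
Proof.
move=> sx.
have s_in (y : T) : y \in mkflag x -> (s y : T) \in mkflag x.
  by move=> yx; rewrite -sx; apply: imset_f.
have in_x :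
    {subset [:: Bot; flag_vert x; flag_edge x; flag_face x; Top] <= mkflag x}.
  by move=> y; rewrite in_set.
have eq_in (y z : T) :
    y \in mkflag x -> z \in mkflag x -> trank y = trank z -> y = z.
  move=> yx zx yz; have /forall_inP/(_ y yx)/forall_inP/(_ z zx) := mkflag_chain x.
  by case/orP=> /tle_trank_eq-> //.
have /and5P[lt1 lt2 lt3 lt4 _] :
    [&& (Bot < flag_vert x)%O, (flag_vert x < flag_edge x)%O,
        (flag_edge x < flag_face x)%O, (flag_face x < Top :> T)%O & true].
  exact: mkflag_sorted.
have lt_rank (y z : T) : (y < z)%O -> (trank (s y) < trank (s z))%N.
  by rewrite -aut_lt tltE => /andP[].
have rk4 (y : T) : (trank y <= 4)%N by case: y.
move/lt_rank: lt1; move/lt_rank: lt2; move/lt_rank: lt3; move/lt_rank: lt4.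
have := rk4 (s (Top : T)) => r5 r4 r3 r2 r1.
(* Five strictly increasing ranks bounded by 4 can only be 0, 1, 2, 3, 4. *)
have [v1 e2 f3] : [/\ trank (s (flag_vert x)) = 1%N, trank (s (flag_edge x)) = 2%N
    & trank (s (flag_face x)) = 3%N] by split; lia.
by split; apply: eq_in; rewrite ?v1 ?e2 ?f3 // ?s_in // in_x // !inE eqxx ?orbT.
Qed.

(** Fixity passes to the flag with the other vertex, by the diamond between [Bot] and the edge. *)
Lemma fixes_flip0 i a e d : fixes ((i, a), (e, d)) -> fixes ((i, a), (~~ e, d)).
Proof.
case=> sv se sf; split=> //.
apply: (fix_between (x := Bot) (z := flag_vert ((i, a), (e, d)))
  _ _ _ _ aut_bot se sv) => //.
- by rewrite !tltE /flag_vert /tle; case: (e); rewrite /= ?addr0 eqxx ?orbT.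
- by rewrite !tltE /flag_vert /tle; case: (e); rewrite /= ?addr0 eqxx ?orbT.
- have Vert_inj : injective (@Vert p m) by move=> j k [].
  apply/eqP => /Vert_inj/addrI/eqP; case: (e) => /=.
    exact/negP/one_neq0.
  by rewrite eq_sym; apply/negP/one_neq0.
Qed.

Lemma fixes_flip2 i a e d : fixes ((i, a), (e, d)) -> fixes ((i, a), (e, ~~ d)).
Proof.
case=> sv se sf; split=> //.
apply: (fix_between (y := Top) (z := flag_face ((i, a), (e, d)))
  _ _ _ _ se aut_top sf) => //.
- by rewrite !tltE /flag_edge /flag_face /tle eqxx.
- by rewrite !tltE /flag_edge /flag_face /tle eqxx.
- by apply/eqP; case: (d); discriminate.
Qed.

(* For d = 0 and d = 1 this passes from the edge (i, a) to (i + 1, a) and to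
   (i + 1, a - 1), and these two steps connect all edges. *)
Lemma fixes_flip1 i a d : fixes ((i, a), (true, d)) ->
  fixes ((i + 1, a - d%:R), (false, d)).
Proof.
case=> sv se sf.
have vE : flag_vert ((i + 1, a - d%:R), (false, d)) = flag_vert ((i, a), (true, d)).
  by congr Vert; rewrite /= addr0.
have fE : flag_face ((i + 1, a - d%:R), (false, d)) = flag_face ((i, a), (true, d)).
  by congr Face; case: d {sv se sf vE}; rewrite /shift /= ?(projE m_dvd_p); ring.
split; rewrite ?vE ?fE //.
apply: (fix_between (z := flag_edge ((i, a), (true, d))) _ _ _ _ sv sf se) => //.
- by rewrite !tltE /flag_vert /flag_edge /flag_face /tle !eqxx orbT.
- rewrite -vE -fE !tltE /flag_vert /flag_edge /flag_face /tle.
  by rewrite /= addr0 !eqxx.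
- apply/eqP => -[/eqP]; rewrite -subr_eq0 opprD addNKr oppr_eq0 => /eqP i1 _.
  by have := one_neq0 p_gt0; rewrite i1 eqxx.
Qed.

Lemma fixes_all i a e d : fixes ((i, a), (e, d)) ->
  forall j b e' d', fixes ((j, b), (e', d')).
Proof.
move=> fix0.
have flip k c e1 d1 : fixes ((k, c), (e1, d1)) ->
    forall e2 d2, fixes ((k, c), (e2, d2)).
  move=> fx e2 d2.
  have [->|/negPf ne] := eqVneq e2 e1; have [->|/negPf nd] := eqVneq d2 d1 => //.
  - by rewrite (_ : d2 = ~~ d1); [apply: fixes_flip2 | case: (d1) (d2) nd => -[]].
  - by rewrite (_ : e2 = ~~ e1); [apply: fixes_flip0 | case: (e1) (e2) ne => -[]].
  - rewrite (_ : e2 = ~~ e1); last by case: (e1) (e2) ne => -[].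
    rewrite (_ : d2 = ~~ d1); last by case: (d1) (d2) nd => -[].
    exact/fixes_flip0/fixes_flip2.
have step k c d1 : (forall e2 d2, fixes ((k, c), (e2, d2))) ->
    forall e2 d2, fixes ((k + 1, c - (nat_of_bool d1)%:R), (e2, d2)).
  move=> fx; apply: flip; exact: fixes_flip1 (fx true d1).
have shift_i k c : (forall e2 d2, fixes ((k, c), (e2, d2))) ->
    forall j e2 d2, fixes ((j, c), (e2, d2)).
  (* The step with d = 0 is repeated j - k times, this residue being read as a natural number. *)
  move=> fx j; rewrite (_ : j = k + (nat_of_ord (j - k))%:R); last first.
    by rewrite natr_Zmod addrC subrK.
  elim: (nat_of_ord _) => [|n IHn]; first by rewrite addr0.
  have := @step _ _ false IHn; rewrite /= subr0.
  by rewrite mulrSr addrA.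
have shift_a k c : (forall e2 d2, fixes ((k, c), (e2, d2))) ->
    forall b e2 d2, fixes ((k, b), (e2, d2)).
  move=> fx b; rewrite (_ : b = c - (nat_of_ord (c - b))%:R); last first.
    by rewrite natr_Zmod subKr.
  elim: (nat_of_ord _) => [|n IHn]; first by rewrite subr0.
  (* From the edge at k - 1, the step with d = 1 returns to k with the second coordinate lowered by
     1. *)
  have := @step _ _ true (shift_i _ _ IHn (k - 1)).
  by rewrite /= subrK ?mulr1n -addrA -opprD -mulrSr.
move=> j b; apply: shift_a; apply: shift_i; exact: flip fix0.
Qed.

Lemma aut_fix1 (x : flagix p m) :
  ('P^*)%act (mkflag x : {set P}) s = mkflag x -> s = 1%g.
Proof.
move/fix_mkflag; case: x => -[i a] [e d] /fixes_all all_fix.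
apply/permP => -[|j|j b|c k|]; rewrite perm1.
- exact: aut_bot.
- by have [+ _ _] := all_fix j 0 false false; rewrite /flag_vert /= addr0.
- by have [_ + _] := all_fix j b false false.
(* The edge (0, c) lies on (c, k) for both kinds k, as the offset vanishes at 0. *)
- have [_ _] := all_fix 0 c false k.
  by rewrite /flag_face /shift /= proj0 if_same addr0.
- exact: aut_top.
Qed.

End Fixing.

Lemma aut_flag_inj (s t : {perm P}) (x : flagix p m) :
  s \in automs P -> t \in automs P ->
  ('P^*)%act (mkflag x : {set P}) s = ('P^*)%act (mkflag x : {set P}) t -> s = t.
Proof.
move=> sA tA st; apply: divg1_eq.
apply: (@aut_fix1 _ _ x); first by rewrite (@groupM _ (automs_group P)) ?groupV.
by rewrite actM st -actM mulgV act1.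
Qed.

End FlagAction.

(* In the computations of flags below, [congr1] replaces [rewrite]: comparing two
   flags up to conversion would unfold the arithmetic of ['I_n]. *)
Lemma subr_natS (V : pzRingType) (x : V) k : (x - k%:R - 1 = x - k.+1%:R)%R.
Proof. by rewrite -addrA -opprD natr1. Qed.

Lemma addr_natS (V : pzRingType) (x : V) k : (x + k%:R + 1 = x + k.+1%:R)%R.
Proof. by rewrite -addrA natr1. Qed.

Lemma subr_natZ n (i : Zmod n) : (i - n.+1%:R = i)%R.
Proof. by rewrite -natr_modZ modnn subr0. Qed.

Lemma addr_natZ n (i : Zmod n) : (i + n.+1%:R = i)%R.
Proof. by rewrite -natr_modZ modnn addr0. Qed.

(** * Normal form of automorphisms, regularity and the rotation subgroup *)

Section AutomorphismGroup.
Variables p m : nat.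
Local Notation T := (tface p m).
Hypothesis p_gt0 : (0 < p)%N.
Hypothesis m_dvd_p : (m.+1 %| p.+1)%N.
Local Notation P := (tight_polytope p_gt0 m_dvd_p).
Local Notation r0 := (refl0 p_gt0 m_dvd_p).
Local Notation r1 := (refl1 p_gt0 m_dvd_p).
Local Notation r2 := (refl2 p_gt0 m_dvd_p).
Local Open Scope group_scope.

Definition base : flagix p m := ((0, 0), (false, false))%R.

Definition act_flag (x : flagix p m) (s : {perm P}) : {set P} :=
  ('P^*)%act (mkflag x : {set P}) s.

Lemma act_flagM x s t y : act_flag x s = mkflag y ->
  act_flag x (s * t) = act_flag y t.
Proof. by move=> xs; rewrite [RHS]/act_flag -xs; apply: actM. Qed.

Lemma flag_rotation0 x :
  act_flag x (r0 * r1) = mkflag ((x.1.1 - 1, x.1.2), x.2)%R.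
Proof.
rewrite (act_flagM _ (refl0_flag p_gt0 m_dvd_p x)) [LHS]refl1_flag; congr mkflag.
by case: x => -[i a] [e d]; rewrite /flag1 /= !opprK negbK.
Qed.

Lemma flag_rotation1 x :
  act_flag x ((r1 * r2) ^+ 2) = mkflag ((x.1.1, x.1.2 + 1), x.2)%R.
Proof.
rewrite expg2 !mulgA (@act_flagM _ _ _ (flag1 (flag2 (flag1 x)))); last first.
  by rewrite /act_flag !actM refl1_flag refl2_flag refl1_flag.
rewrite [LHS]refl2_flag; congr mkflag.
case: x => -[i a] [e d]; rewrite /flag1 /flag2 /= !negbK; congr (_, _, _).
  by ring.
by rewrite !(projE m_dvd_p); ring.
Qed.

Lemma flag_rotation0X x s :
  act_flag x ((r0 * r1) ^+ s) = mkflag ((x.1.1 - s%:R, x.1.2), x.2)%R.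
Proof.
elim: s => [|s IHs].
  by rewrite expg0 /act_flag act1 subr0; case: x => -[].
rewrite expgSr (act_flagM _ IHs) flag_rotation0.
exact: (congr1 (fun j => mkflag ((j, x.1.2), x.2)) (subr_natS x.1.1 s)).
Qed.

Lemma flag_rotation1X x s :
  act_flag x (((r1 * r2) ^+ 2) ^+ s) = mkflag ((x.1.1, x.1.2 + s%:R), x.2)%R.
Proof.
elim: s => [|s IHs].
  by rewrite expg0 /act_flag act1 addr0; case: x => -[].
rewrite expgSr (act_flagM _ IHs) flag_rotation1.
exact: (congr1 (fun b => mkflag ((x.1.1, b), x.2)) (addr_natS x.1.2 s)).
Qed.

(** Permutations act on the right, so the factors apply in the order written, each setting one
    coordinate of the index. *)
Lemma flag_nform d e s t :
  act_flag base (nform r0 r1 r2 d e s t) = mkflag ((- s%:R, t%:R), (e, d))%R.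
Proof.
have flag_d : act_flag base (r2 ^+ d) = mkflag ((0, 0), (false, d))%R.
  case: d; last by rewrite expg0 /act_flag act1.
  rewrite expg1 [LHS]refl2_flag; congr mkflag.
  by rewrite /flag2 /= proj0 !oppr0 addr0.
have flag_de : act_flag base (r2 ^+ d * r0 ^+ e) = mkflag ((0, 0), (e, d))%R.
  rewrite (act_flagM _ flag_d); case: e; last by rewrite expg0 /act_flag act1.
  by rewrite expg1 [LHS]refl0_flag; congr mkflag; rewrite /flag0 /= !oppr0.
have flag_des : act_flag base (r2 ^+ d * r0 ^+ e * (r0 * r1) ^+ s) =
    mkflag ((- s%:R, 0), (e, d))%R.
  rewrite (act_flagM _ flag_de) flag_rotation0X.
  exact: (congr1 (fun j => mkflag ((j, 0%R), (e, d))) (sub0r _)).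
rewrite /nform (act_flagM _ flag_des) flag_rotation1X.
exact: (congr1 (fun b => mkflag (((- s%:R)%R, b), (e, d))) (add0r _)).
Qed.

Lemma aut_gen_mem :
  [/\ r0 \in automs_group P, r1 \in automs_group P & r2 \in automs_group P].
Proof. by split; [apply: refl0_aut | apply: refl1_aut | apply: refl2_aut]. Qed.

(** This lets a relation between automorphisms be checked on the base flag alone. *)
Lemma aut_eq1 s : s \in automs_group P -> act_flag base s = mkflag base -> s = 1.
Proof. by move=> sA; apply: aut_fix1. Qed.

Lemma rotation0X : (r0 * r1) ^+ p.+1 = 1.
Proof.
have [r0A r1A r2A] := aut_gen_mem.
apply: aut_eq1; first by rewrite groupX ?groupM.
rewrite flag_rotation0X.
exact: (congr1 (fun j => mkflag ((j, 0%R), (false, false))) (subr_natZ _)).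
Qed.

Lemma rotation1X : (r1 * r2) ^+ m.+1.*2 = 1.
Proof.
have [r0A r1A r2A] := aut_gen_mem.
apply: aut_eq1; first by rewrite groupX ?groupM.
rewrite -mul2n expgM flag_rotation1X.
exact: (congr1 (fun b => mkflag ((0%R, b), (false, false))) (addr_natZ _)).
Qed.

Lemma refl0K : r0 * r0 = 1.
Proof. by apply/permP => x; rewrite permM !permE; apply: sym0K. Qed.

Lemma refl1K : r1 * r1 = 1.
Proof. by apply/permP => x; rewrite permM !permE; apply: sym1K. Qed.

Lemma refl2K : r2 * r2 = 1.
Proof. by apply/permP => x; rewrite permM !permE; apply: sym2K. Qed.

Lemma refl02X : (r0 * r2) ^+ 2 = 1.
Proof.
have [r0A r1A r2A] := aut_gen_mem.
apply: aut_eq1; first by rewrite groupX ?groupM.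
rewrite expg2 !mulgA /act_flag !actM refl0_flag refl2_flag refl0_flag refl2_flag.
by rewrite /flag0 /flag2 /base /= !oppr0 !proj0 !subr0 !oppr0.
Qed.

Lemma refl01212X : (r0 * r1 * r2 * r1 * r2) ^+ 2 = 1.
Proof.
have [r0A r1A r2A] := aut_gen_mem.
apply: aut_eq1; first by rewrite groupX ?groupM.
(* The factors of the square of r0 N flip the vertex bit, add 1 to the second coordinate, negate it
   while flipping the bit back, and add 1 again. *)
have -> : r0 * r1 * r2 * r1 * r2 = r0 * (r1 * r2) ^+ 2 by rewrite expg2 !mulgA.
have flag_r0 : act_flag base r0 = mkflag ((0, 0), (true, false))%R.
  by rewrite [LHS]refl0_flag /flag0 /= !oppr0.
have flag_r0N : act_flag base (r0 * (r1 * r2) ^+ 2) =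
    mkflag ((0, 1), (true, false))%R.
  rewrite (act_flagM _ flag_r0) flag_rotation1.
  exact: (congr1 (fun b => mkflag ((0%R, b), (true, false))) (add0r _)).
have flag_r0Nr0 : act_flag base (r0 * (r1 * r2) ^+ 2 * r0) =
    mkflag ((0, - 1), (false, false))%R.
  rewrite (act_flagM _ flag_r0N) [LHS]refl0_flag.
  exact: (congr1 (fun j => mkflag ((j, (- 1)%R), (false, false))) (oppr0 _)).
rewrite [X in act_flag _ X]expg2 mulgA (act_flagM _ flag_r0Nr0) flag_rotation1.
exact: (congr1 (fun b => mkflag ((0%R, b), (false, false))) (addNr _)).
Qed.

Lemma aut_nform g : g \in automs_group P ->
  exists d e (s : 'I_p.+1) (t : 'I_m.+1), g = nform r0 r1 r2 d e s t.
Proof.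
have [r0A r1A r2A] := aut_gen_mem => gA.
have /flagsP[[[i a] [e d]] gE] : act_flag base g \in flags P.
  have chg : is_chain (act_flag base g : {set T}).
    apply/forall_inP => _ /imsetP[y yB ->]; apply/forall_inP => _ /imsetP[z zB ->].
    have /forall_inP/(_ y yB)/forall_inP/(_ z zB) := mkflag_chain base.
    by rewrite /Order.comparable /= !(automsP _ gA).
  (* The image of the base flag is a chain of five faces inside a flag of five faces. *)
  have [x gx] := chain_sub_mkflag chg; apply/flagsP; exists x.
  apply/eqP; rewrite eqEcard gx /= card_mkflag card_imset; last exact: perm_inj.
  by rewrite card_mkflag.
(* The exponent is -i because [T ^+ s] lowers the first coordinate by s. *)
exists d, e, (- i)%R, a; apply: (@aut_flag_inj _ _ p_gt0 m_dvd_p _ _ base) => //.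
  by rewrite !(groupM, groupX).
rewrite [LHS]gE [RHS]flag_nform !natr_Zmod.
exact: (congr1 (fun j => mkflag ((j, a), (e, d))) (esym (opprK i))).
Qed.

Lemma nform_inj d e (s : 'I_p.+1) (t : 'I_m.+1) d' e' (s' : 'I_p.+1) (t' : 'I_m.+1) :
  nform r0 r1 r2 d e s t = nform r0 r1 r2 d' e' s' t' ->
  [/\ d = d', e = e', s = s' & t = t'].
Proof.
move/(congr1 (act_flag base)); rewrite !flag_nform !natr_Zmod.
move/(mkflag_inj p_gt0) => /pair_equal_spec[/pair_equal_spec[/oppr_inj-> ->]].
by move/pair_equal_spec=> [-> ->].
Qed.

Lemma tight_polytope_regular : regular P.
Proof.
apply/imsetP; exists (mkflag base : {set P}); first by apply/flagsP; exists base.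
apply/setP => F; apply/flagsP/orbitP => [[[[i a] [e d]] ->]|[g gA <-]].
  have [r0A r1A r2A] := aut_gen_mem.
  exists (nform r0 r1 r2 d e (- i : Zmod p)%R a).
    by rewrite -[_ \in _]/(_ \in automs_group P) !(groupM, groupX).
  rewrite [LHS]flag_nform !natr_Zmod.
  exact: (congr1 (fun j => mkflag ((j, a), (e, d))) (opprK i)).
have [d [e [s [t ->]]]] := aut_nform gA.
by exists ((- s%:R, t%:R), (e, d))%R; apply: flag_nform.
Qed.

Lemma mem_mkflag_bot (x : flagix p m) : Bot \in mkflag x.
Proof. by rewrite !inE. Qed.

Lemma mem_mkflag_top (x : flagix p m) : Top \in mkflag x.
Proof. by rewrite !inE eqxx !orbT. Qed.

Lemma reflectionP (s : {perm P}) (x y : flagix p m) (i : int) :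
  s \in automs P -> act_flag x s = mkflag y -> y != x ->
  (forall z : P, rank z != i -> (z \in mkflag y) = (z \in mkflag x)) ->
  is_reflection (mkflag x : {set P}) i s.
Proof.
move=> sA sx yx same; split=> //; rewrite [X in adjacent _ _ X]sx; split=> //.
- apply/flagsP; exact: ex_intro x erefl.
- apply/flagsP; exact: ex_intro y erefl.
- by rewrite (inj_eq (mkflag_inj p_gt0)).
Qed.

Lemma refl0_reflection : is_reflection (mkflag base : {set P}) 0%Z r0.
Proof.
apply: (reflectionP (y := flag0 base) (refl0_aut _ _)).
- exact: refl0_flag.
- by apply/eqP => /(congr1 (fun z => z.2.1)).
- case=> [|i|i a|c k|] rk.
  + by rewrite [LHS]mem_mkflag_bot [RHS]mem_mkflag_bot.
  + by case/negP: rk.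
  + by rewrite [LHS]mem_mkflag_edge [RHS]mem_mkflag_edge /flag0 !oppr0.
  + by rewrite [LHS]mem_mkflag_face [RHS]mem_mkflag_face /flag0 !oppr0.
  + by rewrite [LHS]mem_mkflag_top [RHS]mem_mkflag_top.
Qed.

Lemma refl1_reflection : is_reflection (mkflag base : {set P}) 1%Z r1.
Proof.
apply: (reflectionP (y := flag1 base) (refl1_aut _ _)).
- exact: refl1_flag.
- by apply/eqP => /(congr1 (fun z => z.2.1)).
- case=> [|i|i a|c k|] rk.
  + by rewrite [LHS]mem_mkflag_bot [RHS]mem_mkflag_bot.
  + by rewrite [LHS]mem_mkflag_vert [RHS]mem_mkflag_vert /flag1 subrK oppr0 addr0.
  + by case/negP: rk.
  + rewrite [LHS]mem_mkflag_face [RHS]mem_mkflag_face /flag1 /base /shift /= !oppr0.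
    (* For kind 0 the offset vanishes; neither flag has a 2-face of kind 1. *)
    by case: k {rk}; rewrite ?andbF.
  + by rewrite [LHS]mem_mkflag_top [RHS]mem_mkflag_top.
Qed.

Lemma refl2_reflection : is_reflection (mkflag base : {set P}) 2%Z r2.
Proof.
apply: (reflectionP (y := flag2 base) (refl2_aut _ _)).
- exact: refl2_flag.
- by apply/eqP => /(congr1 (fun z => z.2.2)).
- case=> [|i|i a|c k|] rk.
  + by rewrite [LHS]mem_mkflag_bot [RHS]mem_mkflag_bot.
  + by rewrite [LHS]mem_mkflag_vert [RHS]mem_mkflag_vert.
  + rewrite [LHS]mem_mkflag_edge [RHS]mem_mkflag_edge.
    by rewrite /flag2 /base proj0 !oppr0 !addr0.
  + by case/negP: rk.
  + by rewrite [LHS]mem_mkflag_top [RHS]mem_mkflag_top.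
Qed.

Definition rotations : {group {perm P}} := [group of <<[set r0 * r1; r1 * r2]>>].

Lemma rotations_sub : rotations \subset automs_group P.
Proof.
have [r0A r1A r2A] := aut_gen_mem.
by rewrite gen_subG; apply/subsetP => g /set2P[]->; rewrite groupM.
Qed.

(* Each of the three reflections exchanges the two kinds of flags, so the
   rotations preserve the even ones. *)
Definition even_flags : {set {set P}} :=
  [set mkflag x | x : flagix p m & x.2.1 == x.2.2].

Lemma rotation_even g : g \in rotations -> act_flag base g \in even_flags.
Proof.
have act_even s : (forall x : flagix p m, x.2.1 == x.2.2 -> exists2 y : flagix p m,
    y.2.1 == y.2.2 & act_flag x s = mkflag y) -> s \in 'N(even_flags | 'P^*).
  move=> even_s; rewrite inE in_setT andTb in_set; apply/subsetP => F /imsetP[x].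
  rewrite inE => /even_s[y y_even sx] ->; rewrite inE.
  by rewrite [X in X \in _]sx; apply: imset_f; rewrite inE.
have : rotations \subset 'N(even_flags | 'P^*).
  rewrite gen_subG; apply/subsetP => g' /set2P[]->; apply: act_even => x x_even.
    exists (flag1 (flag0 x)); first by rewrite /= negbK.
    by rewrite (act_flagM _ (refl0_flag _ _ x)) [LHS]refl1_flag.
  exists (flag2 (flag1 x)); first by rewrite /= (inj_eq negb_inj).
  by rewrite (act_flagM _ (refl1_flag _ _ x)) [LHS]refl2_flag.
move/subsetP => sub /sub gN; rewrite [X in X \in _]/act_flag astabs_act //.
by apply: imset_f; rewrite inE.
Qed.

(** [r0] flips only the vertex bit, so it moves the base flag out of the even ones. *)
Lemma refl0_notin_rotations : r0 \notin rotations.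
Proof.
apply/negP => /rotation_even; rewrite [X in X \in _]refl0_flag.
case/imsetP=> x; rewrite inE => x_even /(mkflag_inj p_gt0) xE.
by rewrite -xE in x_even.
Qed.

(** In the normal form the powers of [T] and [N] are rotations, and so is [r0 * r2]; hence the coset
    depends only on whether d and e agree. *)
Lemma rotations_cover : automs_group P \subset rotations :|: r0 *: rotations.
Proof.
apply/subsetP => g /aut_nform[d [e [s [t ->]]]].
have s1R : r0 * r1 \in rotations by rewrite mem_gen // set21.
have s2R : r1 * r2 \in rotations by rewrite mem_gen // set22.
have r02R : r0 * r2 \in rotations.
  have -> : r0 * r2 = (r0 * r1) * (r1 * r2).
    by rewrite mulgA -(mulgA r0) refl1K mulg1.
  exact: groupM.
have r20 : r2 * r0 = r0 * r2 by rewrite -(r0r2C refl0K refl2K refl02X).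
have stR : (r0 * r1) ^+ s * ((r1 * r2) ^+ 2) ^+ t \in rotations.
  by rewrite groupM ?groupX.
rewrite inE mem_lcoset (mulg1_eq refl0K) /nform -mulgA.
case: d e => -[]; rewrite ?expg0 ?expg1 ?mul1g ?mulg1.
- by rewrite r20 groupM.
- by apply/orP; right; rewrite (mulgA r0 r2) groupM.
- by apply/orP; right; rewrite (mulgA r0 r0) refl0K mul1g.
- by rewrite stR.
Qed.

Lemma rotations_index : #|automs_group P : rotations| = 2.
Proof.
have [r0A r1A r2A] := aut_gen_mem.
have R_gt0 := cardG_gt0 rotations.
have idx1 : #|automs_group P : rotations| != 1%N.
  by rewrite indexg_eq1; apply: contra refl0_notin_rotations => /subsetP; apply.
have idx0 := indexg_gt0 (automs_group P) rotations.
have : #|automs_group P| <= 2 * #|rotations|.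
  apply: leq_trans (subset_leq_card rotations_cover) _.
  by rewrite mul2n -addnn -{2}(card_lcoset rotations r0) leq_card_setU.
rewrite -(Lagrange rotations_sub) mulnC leq_pmul2r //.
by move: idx0 idx1; case: #|_ : _| => [|[|[|?]]].
Qed.

Lemma tight_polytope_orientably_regular : orientably_regular P.
Proof.
split; first exact: tight_polytope_regular.
exists (mkflag base : {set P}), r0, r1, r2; split.
- apply/flagsP; exact: ex_intro base erefl.
- exact: refl0_reflection.
- exact: refl1_reflection.
- exact: refl2_reflection.
- exact: rotations_index.
Qed.

End AutomorphismGroup.

(** * The automorphism group and the presentation *)

Section Isomorphism.
Variables p m : nat.
Hypothesis p_gt0 : (0 < p)%N.
Hypothesis m_dvd_p : (m.+1 %| p.+1)%N.
Local Notation P := (tight_polytope p_gt0 m_dvd_p).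
Local Notation r0 := (refl0 p_gt0 m_dvd_p).
Local Notation r1 := (refl1 p_gt0 m_dvd_p).
Local Notation r2 := (refl2 p_gt0 m_dvd_p).
Local Notation q := (m.+1.*2).
Local Notation R := (Gamma_relators p.+1 q).
Local Open Scope group_scope.

(** Used in both directions: to verify the relators on the reflections, and to extract the relations
    among the generators of the presented group. *)
Lemma gamma_relations (G : groupType) (a : 'I_3 -> G) :
  (forall r, r \in R -> eval_word a r = 1) <->
  [/\ a (inord 0) * a (inord 0) = 1, a (inord 1) * a (inord 1) = 1,
      a (inord 2) * a (inord 2) = 1,
      (a (inord 0) * a (inord 1)) ^+ p.+1 = 1 &
      [/\ (a (inord 1) * a (inord 2)) ^+ q = 1,
       (a (inord 0) * a (inord 2)) ^+ 2 = 1 &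
       (a (inord 0) * a (inord 1) * a (inord 2) * a (inord 1) * a (inord 2)) ^+ 2
         = 1]].
Proof.
have ord k (k3 : k < 3) : Ordinal k3 = inord k by apply: val_inj; rewrite /= inordK.
have e0 : eval_word a rho0 = a (inord 0) by rewrite eval1 ord.
have e1 : eval_word a rho1 = a (inord 1) by rewrite eval1 ord.
have e2 : eval_word a rho2 = a (inord 2) by rewrite eval1 ord.
have evE := (eval_exp, eval_cat, e0, e1, e2, @mulgA G).
split=> [aR|[a0 a1 a2 a01 [a12 a02 a012]] r].
  split; last split; rewrite -?expg2.
  - by rewrite -(aR (word_exp rho0 2)) ?evE // !inE eqxx ?orbT.
  - by rewrite -(aR (word_exp rho1 2)) ?evE // !inE eqxx ?orbT.
  - by rewrite -(aR (word_exp rho2 2)) ?evE // !inE eqxx ?orbT.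
  - by rewrite -(aR (word_exp (rho0 ++ rho1) p.+1)) ?evE // !inE eqxx ?orbT.
  - by rewrite -(aR (word_exp (rho1 ++ rho2) q)) ?evE // !inE eqxx ?orbT.
  - by rewrite -(aR (word_exp (rho0 ++ rho2) 2)) ?evE // !inE eqxx ?orbT.
  - rewrite -(aR (word_exp (rho0 ++ rho1 ++ rho2 ++ rho1 ++ rho2) 2)) ?evE //.
    by rewrite !inE eqxx ?orbT.
by rewrite !inE => /or4P[|||/or4P[]] => /eqP->; rewrite !evE // expg2.
Qed.

Definition refl_of (j : 'I_3) : {perm P} := nth 1 [:: r0; r1; r2] j.

Lemma refl_relations r : r \in R -> eval_word refl_of r = 1.
Proof.
have rE k : k < 3 -> refl_of (inord k) = nth 1 [:: r0; r1; r2] k.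
  by move=> k3; rewrite /refl_of inordK.
move: r; apply/gamma_relations; rewrite !rE //=; split; last split.
- exact: refl0K.
- exact: refl1K.
- exact: refl2K.
- exact: rotation0X.
- exact: rotation1X.
- exact: refl02X.
- exact: refl01212X.
Qed.

Local Notation Gam := (Gamma p.+1 q).
Let g (k : nat) : Gam := pres_gen R (inord k).

Lemma gamma_nform (x : Gam) :
  exists d e (s : 'I_p.+1) (t : 'I_m.+1), x = nform (g 0) (g 1) (g 2) d e s t.
Proof.
have /gamma_relations[g0 g1 g2 g01 [g12 g02 g012]] := @pres_relator _ R.
(* The generators are involutions, so appending an inverse letter reduces to appending a
   generator. *)
have gV (k : 'I_3) : (pres_gen R k)^-1 = pres_gen R k.
  by apply: mulg1_eq; case: k => -[|[|[|]]] // k3;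
    rewrite -[Ordinal k3](inord_val (Ordinal k3)).
suff [d [e [s [t [sp tm ->]]]]] : is_nform (g 0) (g 1) (g 2) p m x.
  by exists d, e, (Ordinal sp), (Ordinal tm).
have stepM y (j : 'I_3) : is_nform (g 0) (g 1) (g 2) p m y ->
    is_nform (g 0) (g 1) (g 2) p m (y * pres_gen R j).
  case: j => -[|[|[|]]] // k3; rewrite -[Ordinal k3](inord_val (Ordinal k3)).
  - exact: is_nform_r0.
  - exact: is_nform_r1.
  - exact: is_nform_r2.
elim/pres_ind: x => [|y j yN|y j yN]; rewrite ?gV; try exact: stepM.
exact: is_nform1.
Qed.

Lemma aut_isomorphic_gamma : isomorphic [subg (automs_group P)]%type Gam.
Proof.
pose phi : Gam -> {perm P} := pres_eval refl_of.
have phiM : {morph phi : x y / x * y} := pres_evalM refl_relations.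
have phi_g k : k < 3 -> phi (g k) = nth 1 [:: r0; r1; r2] k.
  by move=> k3; rewrite [LHS](pres_eval_pi refl_relations) eval1 /refl_of inordK.
have phi1 : phi 1 = 1 by apply: (mulgI (phi 1)); rewrite -phiM !mulg1.
have phiX x n : phi (x ^+ n) = phi x ^+ n.
  by elim: n => [|n IHn]; rewrite ?expg0 // !expgS phiM IHn.
have phi_nform d e s t :
    phi (nform (g 0) (g 1) (g 2) d e s t) = nform r0 r1 r2 d e s t.
  by rewrite /nform !(phiM, phiX) !phi_g.
(* Elements of the presented group have normal forms, and [phi] sends these to normal forms of
   automorphisms, which determine their exponents. *)
have phi_inj : injective phi.
  move=> x y; have [d [e [s [t ->]]]] := gamma_nform x.
  have [d' [e' [s' [t' ->]]]] := gamma_nform y.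
  by rewrite !phi_nform => /nform_inj[-> -> -> ->].
have phi_aut x : phi x \in automs_group P.
  have [d [e [s [t ->]]]] := gamma_nform x; rewrite phi_nform.
  have [r0A r1A r2A] := aut_gen_mem p_gt0 m_dvd_p.
  by rewrite !(groupM, groupX).
have phi_onto h : h \in automs_group P -> exists x, phi x == h.
  move=> /aut_nform[d [e [s [t ->]]]].
  by exists (nform (g 0) (g 1) (g 2) d e s t); rewrite phi_nform.
(* The isomorphism required starts from the automorphism group, so it is the inverse of [phi], by
   choice of preimages. *)
pose psi (h : [subg (automs_group P)]%type) : Gam := xchoose (phi_onto _ (subgP h)).
have psiK h : phi (psi h) = sgval h.
  by apply/eqP; apply: (xchooseP (phi_onto _ (subgP h))).
exists psi; split.
  exists (fun x => subg (automs_group P) (phi x)) => [h|x].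
    by rewrite psiK sgvalK.
  by apply: phi_inj; rewrite psiK subgK.
by move=> h k; apply: phi_inj; rewrite phiM !psiK.
Qed.

End Isomorphism.

Theorem theorem3p1 (p q : nat) (hp : 3 <= p) (hp_odd : odd p)
    (hq_even : ~~ odd q) (hq : q %| 2 * p) :
  exists P : polyhedron,
    [/\ has_type P p q, tight P p q, orientably_regular P
      & isomorphic [subg (automs_group P)] (Gamma p q)].
Proof.
case: p hp hq {hp_odd} => [|p] // hp hq.
have qE : q = q./2.*2 by rewrite -[LHS]odd_double_half (negPf hq_even).
(* The value q = 0 is excluded since 0 does not divide a positive number. *)
case: (q./2) qE hq => [|m] -> hq; first by rewrite dvd0n in hq.
have p_gt0 : 0 < p by exact: ltnW hp.
have m_dvd_p : m.+1 %| p.+1 by rewrite -mul2n dvdn_pmul2l in hq.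
exists (tight_polytope p_gt0 m_dvd_p); split.
- exact: tight_polytope_type.
- exact: tight_polytope_tight.
- exact: tight_polytope_orientably_regular.
- exact: aut_isomorphic_gamma.
Qed.
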